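(* Let $(\mathcal{R},\mu)$ be a $\sigma$-finite resonant measure space, let $\lVert\cdot\rVert_X$ be a rearrangement-invariant quasi-Banach function norm on $\mathcal{M}(\mathcal{R},\mu)$ satisfying (P5) and let $X$ be the corresponding r.i. quasi-Banach function space. Assume that $X$ has the (ACR) property. Then $(X,\xi)^*=X'$, in the sense that a linear functional $\alpha$ on $X$ is continuous with respect to the topology $\xi$ if and only if it can be represented by some uniquely determined function $\varphi\in X'$ via the formula $$\alpha(f)=\int_{\mathcal{R}}\varphi f\,d\mu,\qquad f\in X.$$
   Context: $\mathcal{M}=\mathcal{M}(\mathcal{R},\mu)$ is the set of extended complex-valued $\mu$-measurable functions (identified when equal $\mu$-a.e.), $\mathcal{M}_+$ the non-negative ones; $\lambda$ is Lebesgue measure. For $f\in\mathcal{M}$, $f_*(s)=\mu(\{|f|>s\})$ and $f^*(t)=\inf\{s\ge0:f_*(s)\le t\}$. A $\sigma$-finite $(\mathcal{R},\mu)$ is resonant if $\sup_{\tilde g^*=g^*}\int_{\mathcal{R}}|f\tilde g|\,d\mu=\int_0^\infty f^*g^*\,d\lambda$ for all $f,g\in\mathcal{M}$ (equivalently, it is non-atomic, or completely atomic with all atoms of equal measure). A quasi-Banach function norm is a map $\lVert\cdot\rVert\colon\mathcal{M}\to[0,\infty]$ with $\lVert\,|f|\,\rVert=\lVert f\rVert$ whose restriction to $\mathcal{M}_+$ satisfies: (Q1) it is absolutely homogeneous, vanishes exactly at $f=0$ a.e., and there is $C\ge1$ with $\lVert f+g\rVert\le C(\lVert f\rVert+\lVert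 g\rVert)$; (P2) $f\le g$ a.e. implies $\lVert f\rVert\le\lVert g\rVert$; (P3) $f_n\uparrow f$ a.e. implies $\lVert f_n\rVert\uparrow\lVert f\rVert$; (P4) $\lVert\chi_E\rVert<\infty$ if $\mu(E)<\infty$. Property (P5): if $\mu(E)<\infty$ there is a finite $C_E$ with $\int_E f\,d\mu\le C_E\lVert f\rVert$ for all $f\in\mathcal{M}_+$. It is rearrangement-invariant (r.i.) if $f^*=g^*$ implies $\lVert f\rVert=\lVert g\rVert$. The corresponding space is $X=\{f\in\mathcal{M}:\lVert f\rVert_X<\infty\}$; its associate space is $X'=\{f\in\mathcal{M}:\lVert f\rVert_{X'}<\infty\}$, $\lVert f\rVert_{X'}=\sup_{\lVert g\rVert_X\le1}\int_{\mathcal{R}}|fg|\,d\mu$. $X$ has the (ACR) property if $\lim_{t\to\infty}f^*(t)=0$ for every $f\in X$. $\xi$ is the locally convex topology on $X$ induced by the norms $|f|_\varphi=\int_0^\infty\varphi^*f^*\,d\lambda$, $\varphi\in X'$. $(X,\xi)^*$ is the topological dual. *)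

(* Defs.v *)
From HB Require Import structures.
From mathcomp Require Import all_boot all_order all_algebra.
From mathcomp Require Import complex.
From mathcomp Require Import all_classical all_reals all_analysis.
From mathcomp Require Import measurable_realfun.

Set Implicit Arguments.
Unset Strict Implicit.
Unset Printing Implicit Defensive.

Import Order.TTheory GRing.Theory Num.Theory.
Import numFieldNormedType.Exports.

Local Open Scope classical_set_scope.
Local Open Scope ring_scope.
Local Open Scope ereal_scope.

(* [None] is the point at infinity. *)
Definition ecomplex (R : realType) : Type := option R[i].

Section ecomplex.
Variable R : realType.
Implicit Types z w : ecomplex R.

Definition ecabs z : \bar R :=
  if z is Some c then (ComplexField.Normc.normc c)%:E else +oo.

(* Embedding of [0, +oo] (used on nonnegative arguments only). *)
Definition ec_of_ereal (x : \bar R) : ecomplex R :=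
  if x is r%:E then Some (r%:C)%C else None.

(* The functions of the space X considered below are finite almost everywhere,
   so the value of a sum with an infinite term is immaterial. *)
Definition ecadd z w : ecomplex R :=
  if (z, w) is (Some a, Some b) then Some (a + b)%R else None.

(* As for extended reals, 0 times infinity is 0. *)
Definition ecmul z w : ecomplex R :=
  match z, w with
  | Some a, Some b => Some (a * b)%R
  | Some a, None => if a == 0%R then Some 0%R else None
  | None, Some b => if b == 0%R then Some 0%R else None
  | None, None => None
  end.

(* Real and imaginary part, with junk value 0 at infinity. *)
Definition ecRe z : R := if z is Some c then complex.Re c else 0%R.
Definition ecIm z : R := if z is Some c then complex.Im c else 0%R.

End ecomplex.

Section rearrangement.
Context d (T : measurableType d) (R : realType).
Variable mu : {measure set T -> \bar R}.
Implicit Types (f g : T -> ecomplex R) (u v : T -> \bar R).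

(* Functions are not quotiented by equality almost everywhere: equalities
   between elements of M are stated almost everywhere instead, and the norms
   below take the same value on functions equal almost everywhere (for rho this
   follows from qbfn_abs and qbfn_le). *)
Definition Mfun : set (T -> ecomplex R) := [set f |
  [/\ measurable [set x | f x = None],
      measurable_fun [set: T] (fun x => ecRe (f x)) &
      measurable_fun [set: T] (fun x => ecIm (f x))]].

Definition Mplus : set (T -> \bar R) := [set u |
  measurable_fun [set: T] u /\ forall x, 0 <= u x].

Definition distribution_fun f (s : R) : \bar R :=
  mu [set x | s%:E < ecabs (f x)].

Definition rearrangement f (t : R) : \bar R :=
  ereal_inf [set s%:E | s in
    [set s : R | (0 <= s)%R /\ distribution_fun f s <= t%:E]].

Definition equimeasurable f g : Prop :=
  forall t : R, (0 <= t)%R -> rearrangement f t = rearrangement g t.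

(* The integral over (0, oo) of f^* g^*. *)
Definition rearrangement_pairing f g : \bar R :=
  \int[@lebesgue_measure R]_(t in `[0%R, +oo[)
    (rearrangement f t * rearrangement g t).

Definition resonant : Prop := forall f g, Mfun f -> Mfun g ->
  ereal_sup [set \int[mu]_x (ecabs (f x) * ecabs (g' x)) | g' in
    [set g' | Mfun g' /\ equimeasurable g' g]] = rearrangement_pairing f g.

(* The integral of a complex function; it is used only for functions whose
   modulus has a finite integral. *)
Definition complex_integral f : R[i] :=
  ((\int[mu]_x ecRe (f x))%R +i* (\int[mu]_x ecIm (f x))%R)%C.

Section norm.
Variable rho : (T -> ecomplex R) -> \bar R.

Definition norm_plus u : \bar R := rho (fun x => ec_of_ereal (u x)).

Record quasi_banach_function_norm : Prop := QuasiBanachFunctionNorm {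
  qbfn_ge0 : forall f, Mfun f -> 0 <= rho f ;
  qbfn_abs : forall f, Mfun f -> norm_plus (fun x => ecabs (f x)) = rho f ;
  qbfn_homogeneous : forall (a : R[i]) u, Mplus u ->
    rho (fun x => ecmul (Some a) (ec_of_ereal (u x))) =
      ecabs (Some a) * norm_plus u ;
  qbfn_eq0 : forall u, Mplus u ->
    (norm_plus u = 0 <-> {ae mu, forall x, u x = 0}) ;
  qbfn_triangle : exists2 C : R, (1 <= C)%R & forall u v, Mplus u -> Mplus v ->
    norm_plus (fun x => u x + v x) <= C%:E * (norm_plus u + norm_plus v) ;
  qbfn_le : forall u v, Mplus u -> Mplus v ->
    {ae mu, forall x, u x <= v x} -> norm_plus u <= norm_plus v ;
  qbfn_monotone : forall (u_ : nat -> T -> \bar R) u,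
    (forall n, Mplus (u_ n)) -> Mplus u ->
    {ae mu, forall x, nondecreasing_seq (fun n => u_ n x) /\
                      u_ n x @[n --> \oo] --> u x} ->
    nondecreasing_seq (fun n => norm_plus (u_ n)) /\
    norm_plus (u_ n) @[n --> \oo] --> norm_plus u ;
  qbfn_indic : forall E : set T, measurable E -> mu E < +oo ->
    norm_plus (fun x => (\1_E x)%:E) < +oo
}.

Definition P5 : Prop := forall E : set T, measurable E -> mu E < +oo ->
  exists C : R, forall u, Mplus u -> \int[mu]_(x in E) u x <= C%:E * norm_plus u.

Definition rearrangement_invariant : Prop := forall f g, Mfun f -> Mfun g ->
  equimeasurable f g -> rho f = rho g.

Definition function_space : set (T -> ecomplex R) :=
  [set f | Mfun f /\ rho f < +oo].

Definition associate_norm f : \bar R :=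
  ereal_sup [set \int[mu]_x (ecabs (f x) * ecabs (g x)) | g in
    [set g | Mfun g /\ rho g <= 1]].

Definition associate_space : set (T -> ecomplex R) :=
  [set f | Mfun f /\ associate_norm f < +oo].

Definition ACR : Prop := forall f, function_space f ->
  rearrangement f t @[t --> +oo%R] --> (0 : \bar R).

End norm.
End rearrangement.

Section xi_topology.
Context d (T : measurableType d) (R : realType).

(* The set X as a type, carrying the topology xi; mu is a parameter because
   the topology depends on it. *)
Definition xi_space (mu : {measure set T -> \bar R})
    (rho : (T -> ecomplex R) -> \bar R) : Type :=
  {f : T -> ecomplex R | function_space rho f}.

Variable mu : {measure set T -> \bar R}.
Variable rho : (T -> ecomplex R) -> \bar R.
Local Notation X := (xi_space mu rho).

HB.instance Definition _ := gen_eqMixin X.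
HB.instance Definition _ := gen_choiceMixin X.

Definition xi_ball (phi : T -> ecomplex R) (f : X) (e : R) : set X :=
  [set g | rearrangement_pairing mu phi
    (fun x => ecadd (sval g x) (ecmul (Some (-1)%R) (sval f x))) < e%:E].

HB.instance Definition _ := @isSubBaseTopological.Build X
  (set X)
  [set B | exists phi f e, [/\ associate_space mu rho phi, (0 < e)%R &
                               B = xi_ball phi f e]]
  id.

(* Addition and scaling in X are defined up to equality almost everywhere only;
   a = 0 shows that alpha depends only on the almost everywhere class. *)
Definition linear_functional (alpha : X -> R[i]) : Prop :=
  forall (a : R[i]) (f g h : X),
    {ae mu, forall x,
      sval h x = ecadd (ecmul (Some a) (sval f x)) (sval g x)} ->
    alpha h = (a * alpha f + alpha g)%R.

End xi_topology.

(* Main.v *)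
From HB Require Import structures.
Require Import Defs.
From mathcomp Require Import all_boot all_order all_algebra.
From mathcomp Require Import complex finmap.
From mathcomp Require Import all_classical all_reals all_analysis.
From mathcomp Require Import measurable_realfun.
From mathcomp Require Import ring lra.
Import Order.TTheory GRing.Theory Num.Theory.
Import numFieldNormedType.Exports.
Local Open Scope classical_set_scope.
Local Open Scope ring_scope.
Set Implicit Arguments.
Unset Strict Implicit.
Unset Printing Implicit Defensive.

(** Write [f|phi] for the integral of phi^* f^* over the half-line, the seminorm
    of f that phi defines.  Resonance says that [f|phi] is the supremum of the
    integrals of |f phi'| over all phi' equimeasurable with phi, and also the
    supremum of the integrals of |f' phi| over all f' equimeasurable with f.
    Everything that is needed about the seminorms follows from this: the triangle
    inequality ([pairing_add]), the bound of the integral of |phi f| by [f|phi]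
    ([integral_le_pairing]) and, since the norm is rearrangement-invariant, the
    bound of [f|phi] by the product of the norms of phi in X' and of f in X
    ([pairing_le_norm]).  The bound by the seminorm makes the integral against
    phi a continuous functional ([integral_functional_continuous]).

    Let conversely alpha be continuous for xi.  Two consequences of continuity
    suffice.  First, alpha is order continuous: if real functions v_n of X
    decrease to 0 pointwise, property (ACR) gives finite measure to the sets
    where v_n > s > 0, hence these measures tend to 0, hence v_n^* tends to 0 on
    the open half-line, hence [v_n|phi] tends to 0 by dominated convergence
    ([pairing_cvg0]).  Second, alpha is bounded on the unit ball of X
    ([xi_continuous_bounded]), because h_n / n tends to 0 for xi whenever the
    norms of the h_n are bounded.

    The representing function comes from the theorem of Radon and Nikodym, for
    the real and for the imaginary part of alpha separately
    ([order_continuous_representation]).  To work on the whole space at once,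
    rather than on an exhausting sequence of sets of finite measure, one takes a
    strictly positive function w of X ([exists_positive_real_space]).  Then
    A |-> alpha (w 1_A) is a finite charge, absolutely continuous with respect to
    mu; if D is its density, the representing function is D / w.  The formula
    holds for w s with s simple by linearity, and for a nonnegative u by order
    continuity, as u is the increasing limit of the w s_n for simple s_n
    increasing to u / w.  That D / w belongs to X' is the boundedness of alpha on
    the functions w s_n sgn D.

    Uniqueness is tested on the functions w 1_A
    ([associate_space_unique]). *)

(** * Extended complex numbers *)

Section extended_complex_numbers.
Local Open Scope ereal_scope.
Local Notation normc := ComplexField.Normc.normc.
Context {R : realType}.
Implicit Types (z w : ecomplex R) (x : \bar R).

Lemma ecabs_ge0 z : 0 <= ecabs z.
Proof. by case: z => [[a b]|] //=; rewrite lee_fin sqrtr_ge0. Qed.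

Lemma ecabs_ReIm z : z <> None ->
  ecabs z = (Num.sqrt (ecRe z ^+ 2 + ecIm z ^+ 2))%:E.
Proof. by case: z => [[a b]|]. Qed.

Lemma normc_real (r : R) : normc (r%:C)%C = `|r|%R.
Proof. by rewrite /= expr0n /= addr0 sqrtr_sqr. Qed.

Lemma normc_ge0 (c : R[i]) : (0 <= normc c)%R.
Proof. by case: c => a b; exact: sqrtr_ge0. Qed.

Lemma ecabs_real (r : R) : ecabs (Some (r%:C)%C) = `|r|%:E.
Proof. by rewrite /ecabs normc_real. Qed.

Lemma ecabs_of_ereal x : 0 <= x -> ecabs (ec_of_ereal x) = x.
Proof. by case: x => [r| |] // r0; rewrite ecabs_real ger0_norm. Qed.

Lemma ecRe_of_ereal x : ecRe (ec_of_ereal x) = fine x.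
Proof. by case: x. Qed.

Lemma ecIm_of_ereal x : ecIm (ec_of_ereal x) = 0%R.
Proof. by case: x. Qed.

Lemma ec_of_ereal_None x : 0 <= x -> (ec_of_ereal x = None) = (x = +oo).
Proof. by case: x => [r| |] // _; apply/propext; split. Qed.

Lemma norm_ecRe_le z : `|ecRe z|%:E <= ecabs z.
Proof.
case: z => [[a b]|] /=; last by rewrite normr0 leey.
by rewrite lee_fin -sqrtr_sqr ler_sqrt ?lerDl ?sqr_ge0 // addr_ge0 ?sqr_ge0.
Qed.

Lemma norm_ecIm_le z : `|ecIm z|%:E <= ecabs z.
Proof.
case: z => [[a b]|] /=; last by rewrite normr0 leey.
by rewrite lee_fin -sqrtr_sqr ler_sqrt ?lerDr ?sqr_ge0 // addr_ge0 ?sqr_ge0.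
Qed.

Lemma normc_le (c : R[i]) :
  (normc c <= `|complex.Re c| + `|complex.Im c|)%R.
Proof.
case: c => a b /=; rewrite -(@ger0_norm _ (`|a| + `|b|)%R) ?addr_ge0 //.
rewrite -sqrtr_sqr ler_sqrt ?sqr_ge0 //.
rewrite -(real_normK (num_real a)) -(real_normK (num_real b)).
have := normr_ge0 a; have := normr_ge0 b; nra.
Qed.

Lemma Re_le_normc (c : R[i]) : (`|complex.Re c| <= normc c)%R.
Proof. by rewrite -lee_fin; exact: (norm_ecRe_le (Some c)). Qed.

Lemma Im_le_normc (c : R[i]) : (`|complex.Im c| <= normc c)%R.
Proof. by rewrite -lee_fin; exact: (norm_ecIm_le (Some c)). Qed.

Lemma ecsubrr (c : R[i]) :
  ecadd (Some c) (ecmul (Some (-1)%R) (Some c)) = Some 0%R.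
Proof. by rewrite /ecadd /ecmul mulN1r subrr. Qed.

Lemma ecaddC z w : ecadd z w = ecadd w z.
Proof. by case: z w => [z|] [w|] //; rewrite /ecadd addrC. Qed.

Lemma ecadd0l z : ecadd (Some (0%:C)%C) z = z.
Proof.
by case: z => [c|] //; rewrite /ecadd -[(0%:C)%C]/(0%R : R[i]) add0r.
Qed.

Lemma ecabs_add z w : ecabs (ecadd z w) <= ecabs z + ecabs w.
Proof.
have neNy (v : ecomplex R) : ecabs v != -oo.
  by rewrite gt_eqF // (lt_le_trans _ (ecabs_ge0 v)).
case: z => [z|]; last by rewrite addye ?leey.
case: w => [w|]; last by rewrite addey ?leey.
by rewrite /= -EFinD lee_fin; exact: le_normcD.
Qed.

Lemma ecabs_mul z w : ecabs (ecmul z w) = ecabs z * ecabs w.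
Proof.
have nc0 (c : R[i]) : (0 < normc c)%R = (c != 0%R) :> bool.
  apply/idP/idP => [|c0].
    by apply: contraTneq => ->; rewrite ComplexField.Normc.normc0 ltxx.
  rewrite lt0r normc_ge0 andbT.
  by apply: contra_neq c0; exact: ComplexField.Normc.eq0_normc.
case: z w => [z|] [w|] /=; last by [].
- by rewrite ComplexField.Normc.normcM EFinM.
- case: eqVneq => [->|z0].
    by rewrite /ecabs ComplexField.Normc.normc0 mul0e.
  by rewrite gt0_muley // lte_fin nc0.
- case: eqVneq => [->|z0].
    by rewrite /ecabs ComplexField.Normc.normc0 mule0.
  by rewrite gt0_mulye // lte_fin nc0.
Qed.

Lemma ecRe_mul z w :
  ecRe (ecmul z w) = (ecRe z * ecRe w - ecIm z * ecIm w)%R.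
Proof.
case: z w => [[a b]|] [[a' b']|] //=; try case: ifP => _ /=;
  by rewrite ?(mulr0, mul0r, subrr).
Qed.

Lemma ecIm_mul z w :
  ecIm (ecmul z w) = (ecRe z * ecIm w + ecIm z * ecRe w)%R.
Proof.
case: z w => [[a b]|] [[a' b']|] //=; try case: ifP => _ /=;
  by rewrite ?(mulr0, mul0r, addr0).
Qed.

(** Needed to see that the product of two measurable functions takes the value
    infinity on a measurable set. *)
Lemma ecmul_None z w : ecmul z w = None <->
  (z = None /\ w <> Some 0%R) \/ (w = None /\ z <> Some 0%R).
Proof.
case: z w => [z|] [w|] /=; try case: eqVneq => [->|z0]; split => //;
  try by move=> [[//]|[//]]; try by move=> [[_ []]|[_ []]].
- by right; split => // -[] /eqP; exact/negP.
- by left; split => // -[] /eqP; exact/negP.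
- by left.
Qed.

Lemma ec_eq0 z : (z = Some 0%R) <->
  (z <> None /\ ecRe z = 0%R /\ ecIm z = 0%R).
Proof.
by case: z => [[a b]|]; split; [case=> -> ->|case=> _ /= [-> ->]| |case].
Qed.

End extended_complex_numbers.

(** * Measurable extended complex functions *)

Section measurability.
Local Open Scope ereal_scope.
Context d (T : measurableType d) (R : realType).
Implicit Types (f g : T -> ecomplex R) (u v : T -> \bar R) (a b : T -> R).

Lemma measurable_mem (A : set T) : measurable A ->
  measurable_fun setT (fun x => x \in A).
Proof.
move=> mA; apply: (measurable_fun_bool true) => //=; rewrite setTI.
rewrite [X in measurable X](_ : _ = A) //.
by apply/seteqP; split => x /=; [move/set_mem|exact: mem_set].
Qed.

Lemma Mfun_ecabs f : Mfun f -> measurable_fun setT (fun x => ecabs (f x)).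
Proof.
move=> [mN mRe mIm].
pose r x := Num.sqrt (ecRe (f x) ^+ 2 + ecIm (f x) ^+ 2)%R.
have mr : measurable_fun setT r.
  apply: measurableT_comp.
    exact: (continuous_measurable_fun (@sqrt_continuous R)).
  by apply: measurable_funD; exact: measurable_funX.
rewrite [X in measurable_fun _ X](_ : _ = fun x =>
  if x \in [set x | f x = None] then cst +oo x else (r x)%:E); last first.
  apply/funext => x; case: ifPn => [/set_mem /= -> //|/negP fx].
  by apply: ecabs_ReIm => /mem_set.
apply: measurable_fun_ifT => //; first exact: measurable_mem.
exact/measurable_EFinP.
Qed.

Lemma Mfun_of_ereal u : Mplus u -> Mfun (fun x => ec_of_ereal (u x)).
Proof.
move=> [mu u0]; split.
- rewrite [X in measurable X](_ : _ = u @^-1` [set +oo]).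
    by rewrite -[X in measurable X]setTI; exact: mu.
  by apply/seteqP; split => x /=; rewrite ec_of_ereal_None.
- by under eq_fun do rewrite ecRe_of_ereal; exact: measurableT_comp.
- by under eq_fun do rewrite ecIm_of_ereal; exact: measurable_cst.
Qed.

Lemma Mfun_ReIm a b : measurable_fun setT a -> measurable_fun setT b ->
  Mfun (fun x => Some (a x +i* b x)%C).
Proof.
move=> ma mb; split => //=.
by rewrite [X in measurable X](_ : _ = set0) //; apply/seteqP; split.
Qed.

Lemma Mfun_real a : measurable_fun setT a -> Mfun (fun x => Some (a x)%:C%C).
Proof. by move=> ma; exact: Mfun_ReIm. Qed.

Lemma Mfun_cst (c : R[i]) : Mfun (fun _ : T => Some c).
Proof. by case: c => a b; exact: Mfun_ReIm. Qed.

Lemma Mplus_ecabs f : Mfun f -> Mplus (fun x => ecabs (f x)).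
Proof. by move=> mf; split; [exact: Mfun_ecabs|move=> x; exact: ecabs_ge0]. Qed.

(** Applied to the real and the imaginary part; both vanish at infinity, where
    a sum is located as soon as one of its terms is. *)
Lemma measurable_part_add (p : ecomplex R -> R) f g : p None = 0%R ->
  (forall a b : R[i], p (Some (a + b)%R) = (p (Some a) + p (Some b))%R) ->
  Mfun f -> Mfun g -> measurable_fun setT (p \o f) ->
  measurable_fun setT (p \o g) ->
  measurable_fun setT (fun x => p (ecadd (f x) (g x))).
Proof.
move=> p0 pD [mN _ _] [mN' _ _] mpf mpg.
have mU := measurableU _ _ mN mN'.
have mC : measurable_fun setT
    (\1_(~` ([set x | f x = None] `|` [set x | g x = None])) : T -> R).
  by apply: measurable_indic; exact: measurableC.
have := measurable_funM (measurable_funD mpf mpg) mC.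
congr measurable_fun; apply/funext => x /=; rewrite indicE in_setC.
case: (boolP (_ \in _)) => [/set_mem /= [] ->|/negP fgx];
    rewrite /= ?mulr0 ?mulr1.
- by rewrite p0.
- by case: (f x) => [?|] /=; rewrite p0.
- have {}fgx : ~ (f x = None \/ g x = None).
    by apply: contra_not fgx; exact: mem_set.
  case: (f x) (g x) fgx => [a|] [b|] h; first by rewrite /= pD.
  - by exfalso; apply: h; right.
  - by exfalso; apply: h; left.
  - by exfalso; apply: h; left.
Qed.

Lemma Mfun_add f g : Mfun f -> Mfun g -> Mfun (fun x => ecadd (f x) (g x)).
Proof.
move=> mf mg; have [mN mRe mIm] := mf; have [mN' mRe' mIm'] := mg.
split.
- rewrite [X in measurable X](_ : _ =
    [set x | f x = None] `|` [set x | g x = None]); first exact: measurableU.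
  apply/seteqP; split => x /=; case: (f x) (g x) => [?|] [?|] //=.
  - by move=> _; right.
  - by move=> _; left.
  - by move=> _; left.
  - by case.
- by apply: measurable_part_add => // -[? ?] [? ?].
- by apply: measurable_part_add => // -[? ?] [? ?].
Qed.

Lemma Mfun_mul f g : Mfun f -> Mfun g -> Mfun (fun x => ecmul (f x) (g x)).
Proof.
have m0 h : Mfun h -> measurable [set x | h x = Some 0%R].
  move=> [mN mRe mIm].
  rewrite [X in measurable X](_ : _ = ~` [set x | h x = None] `&`
    ((fun x => ecRe (h x)) @^-1` [set 0%R] `&`
     (fun x => ecIm (h x)) @^-1` [set 0%R])).
    apply: measurableI; [exact: measurableC|apply: measurableI].
      by rewrite -[X in measurable X]setTI; exact: mRe.
    by rewrite -[X in measurable X]setTI; exact: mIm.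
  by apply/seteqP; split => x /= /ec_eq0.
move=> mf mg; have [mN mRe mIm] := mf; have [mN' mRe' mIm'] := mg; split.
- rewrite [X in measurable X](_ : _ =
    ([set x | f x = None] `&` ~` [set x | g x = Some 0%R]) `|`
    ([set x | g x = None] `&` ~` [set x | f x = Some 0%R])).
    by apply: measurableU; apply: measurableI => //; apply: measurableC;
       exact: m0.
  by apply/seteqP; split => x /= /ecmul_None.
- under eq_fun do rewrite ecRe_mul.
  by apply: measurable_funB; exact: measurable_funM.
- under eq_fun do rewrite ecIm_mul.
  by apply: measurable_funD; exact: measurable_funM.
Qed.

End measurability.

(** * The space X *)

Definition cplx (T : Type) (R : realType) (u : T -> R) : T -> ecomplex R :=
  fun x => Some (u x)%:C%C.

Definition real_space d (T : measurableType d) (R : realType)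
    (rho : (T -> ecomplex R) -> \bar R) : set (T -> R) :=
  [set u | measurable_fun [set: T] u /\ (rho (cplx u) < +oo)%E].

(** The difference as it enters the definition of the topology. *)
Definition ecsub (T : Type) (R : realType) (f g : T -> ecomplex R) :
    T -> ecomplex R :=
  fun x => ecadd (f x) (ecmul (Some (-1)%R) (g x)).

Section norm_facts.
Local Open Scope ereal_scope.
Context d (T : measurableType d) (R : realType).
Context (mu : {measure set T -> \bar R}) (rho : (T -> ecomplex R) -> \bar R).
Hypothesis rhoN : quasi_banach_function_norm mu rho.
Implicit Types (f g : T -> ecomplex R) (u v : T -> R).

Lemma ecabs_cplx u x : ecabs (cplx u x) = `|u x|%:E.
Proof. exact: ecabs_real. Qed.

Lemma cplx_Mfun u : measurable_fun setT u -> Mfun (cplx u).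
Proof. exact: Mfun_real. Qed.

Lemma rho_le f g : Mfun f -> Mfun g ->
  {ae mu, forall x, ecabs (f x) <= ecabs (g x)} -> rho f <= rho g.
Proof.
move=> mf mg fg; rewrite -(qbfn_abs rhoN mf) -(qbfn_abs rhoN mg).
by apply: (qbfn_le rhoN) => //; exact: Mplus_ecabs.
Qed.

Lemma rho_eq f g : Mfun f -> Mfun g ->
  (forall x, ecabs (f x) = ecabs (g x)) -> rho f = rho g.
Proof.
by move=> mf mg fg; apply/eqP; rewrite eq_le; apply/andP; split;
  apply: rho_le => //; apply: aeW => x; rewrite fg.
Qed.

(** Homogeneity is an axiom for nonnegative functions only; it extends to M
    because the norm of f is the norm of |f|. *)
Lemma rho_scale (c : R[i]) f : Mfun f ->
  rho (fun x => ecmul (Some c) (f x)) =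
  (ComplexField.Normc.normc c)%:E * rho f.
Proof.
move=> mf; rewrite -(qbfn_abs rhoN mf).
rewrite -[(ComplexField.Normc.normc c)%:E]/(ecabs (Some c)).
rewrite -(qbfn_homogeneous rhoN); last exact: Mplus_ecabs.
have mc := Mfun_cst T c.
apply: rho_eq.
- exact: Mfun_mul.
- by apply: Mfun_mul => //; apply: Mfun_of_ereal; exact: Mplus_ecabs.
- by move=> x; rewrite !ecabs_mul ecabs_of_ereal // ecabs_ge0.
Qed.

Lemma rho_add_lty f g : Mfun f -> Mfun g -> rho f < +oo -> rho g < +oo ->
  rho (fun x => ecadd (f x) (g x)) < +oo.
Proof.
move=> mf mg rf rg.
have [C C1 triC] := qbfn_triangle rhoN.
have pf := Mplus_ecabs mf; have pg := Mplus_ecabs mg.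
have pfg : Mplus (fun x => ecabs (f x) + ecabs (g x)).
  split; last by move=> x; rewrite adde_ge0 // ecabs_ge0.
  by apply: emeasurable_funD; [case: pf|case: pg].
apply: (@le_lt_trans _ _
  (norm_plus rho (fun x => ecabs (f x) + ecabs (g x)))).
  rewrite -(qbfn_abs rhoN); last exact: Mfun_add.
  apply: (qbfn_le rhoN) => //; first by apply: Mplus_ecabs; exact: Mfun_add.
  by apply: aeW => x; exact: ecabs_add.
apply: le_lt_trans (triC _ _ pf pg) _.
rewrite (qbfn_abs rhoN mf) (qbfn_abs rhoN mg).
apply: lte_mul_pinfty => //; last exact: lte_add_pinfty.
by rewrite lee_fin (le_trans _ C1).
Qed.

Lemma rho_cplx0 : rho (cplx (fun=> 0%R)) = 0.
Proof.
rewrite -[LHS]/(norm_plus rho (fun _ : T => 0)).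
by apply/(qbfn_eq0 rhoN); [split|exact: aeW].
Qed.

Lemma rho_eq0 f : Mfun f -> rho f = 0 -> {ae mu, forall x, ecabs (f x) = 0}.
Proof.
move=> mf; rewrite -(qbfn_abs rhoN mf).
by move/(qbfn_eq0 rhoN (Mplus_ecabs mf)).
Qed.

(** The function n equal to infinity where f is, and to 0 elsewhere, satisfies
    2 n = n and is dominated by f; homogeneity forces its norm to be 0. *)
Lemma function_space_ae_finite f : function_space rho f ->
  {ae mu, forall x, f x <> None}.
Proof.
move=> [mf rf]; have [mN _ _] := mf.
pose n x : ecomplex R := if x \in [set x | f x = None] then None else Some 0%R.
have mn : Mfun n.
  rewrite (_ : n = fun x =>
      ec_of_ereal (if x \in [set x | f x = None] then +oo else 0)).
    apply: Mfun_of_ereal; split; last by move=> x; case: ifP.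
    by apply: measurable_fun_ifT => //; exact: measurable_mem.
  by apply/funext => x; rewrite /n; case: ifP.
have rn : rho n <= rho f.
  apply: rho_le => //; apply: aeW => x; rewrite /n.
  case: ifPn => [/set_mem /= -> //|_].
  by rewrite /ecabs ComplexField.Normc.normc0; exact: ecabs_ge0.
have : rho n = 0.
  have := rho_scale ((2 : R)%:C)%C mn.
  rewrite (_ : (fun x => ecmul _ (n x)) = n); last first.
    apply/funext => x; rewrite /n; case: ifP => //= _; last by rewrite mulr0.
    by rewrite eq_complex /= pnatr_eq0.
  rewrite normc_real ger0_norm //.
  have : rho n \is a fin_num.
    rewrite ge0_fin_numE; first exact: le_lt_trans rn rf.
    exact: (qbfn_ge0 rhoN).
  case: (rho n) => // r _; rewrite -EFinM => -[r2]; congr EFin; lra.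
move/(rho_eq0 mn); apply: filterS => x; rewrite /n.
by case: ifPn => // /negP h _ fx; apply: h; exact: mem_set.
Qed.

Lemma real_space_le u v : real_space rho u -> measurable_fun setT v ->
  (forall x, `|v x| <= `|u x|)%R -> real_space rho v.
Proof.
move=> [mu' ru] mv vu; split => //; apply: le_lt_trans ru.
apply: rho_le; [exact: cplx_Mfun..|].
by apply: aeW => x; rewrite !ecabs_cplx lee_fin.
Qed.

Lemma real_space_add u v : real_space rho u -> real_space rho v ->
  real_space rho (fun x => u x + v x)%R.
Proof.
move=> [mu' ru] [mv rv]; split; first exact: measurable_funD.
have := rho_add_lty (cplx_Mfun mu') (cplx_Mfun mv) ru rv.
congr (rho _ < _); apply/funext => x.
by rewrite /ecadd /cplx rmorphD.
Qed.

Lemma rho_cplx_scale (c : R) u : measurable_fun setT u ->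
  rho (cplx (fun x => c * u x)%R) = `|c|%:E * rho (cplx u).
Proof.
move=> mu'; rewrite -normc_real -(rho_scale _ (cplx_Mfun mu')).
by congr rho; apply/funext => x; rewrite /ecmul /cplx rmorphM.
Qed.

Lemma real_space_scale (c : R) u : real_space rho u ->
  real_space rho (fun x => c * u x)%R.
Proof.
move=> [mu' ru]; split; first exact: measurable_funM.
by rewrite rho_cplx_scale //; apply: lte_mul_pinfty.
Qed.

Lemma real_space0 : real_space rho (fun _ : T => 0%R).
Proof. by split => //; rewrite rho_cplx0. Qed.

Lemma function_space_Re f : function_space rho f ->
  real_space rho (fun x => ecRe (f x)).
Proof.
move=> [mf rf]; have [_ mRe _] := mf; split => //; apply: le_lt_trans rf.
apply: rho_le => //; first exact: cplx_Mfun.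
by apply: aeW => x; rewrite ecabs_cplx norm_ecRe_le.
Qed.

Lemma function_space_Im f : function_space rho f ->
  real_space rho (fun x => ecIm (f x)).
Proof.
move=> [mf rf]; have [_ _ mIm] := mf; split => //; apply: le_lt_trans rf.
apply: rho_le => //; first exact: cplx_Mfun.
by apply: aeW => x; rewrite ecabs_cplx norm_ecIm_le.
Qed.

Lemma cplx_function_space u : real_space rho u -> function_space rho (cplx u).
Proof. by move=> [mu' ru]; split => //; exact: cplx_Mfun. Qed.

Lemma function_space_add f g : function_space rho f -> function_space rho g ->
  function_space rho (fun x => ecadd (f x) (g x)).
Proof.
by move=> [mf rf] [mg rg]; split; [exact: Mfun_add|exact: rho_add_lty].
Qed.

Lemma function_space_scale (c : R[i]) f : function_space rho f ->
  function_space rho (fun x => ecmul (Some c) (f x)).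
Proof.
move=> [mf rf]; split; first by apply: Mfun_mul => //; exact: Mfun_cst.
rewrite rho_scale //; apply: lte_mul_pinfty => //.
by rewrite lee_fin normc_ge0.
Qed.

Lemma function_space_sub f g : function_space rho f -> function_space rho g ->
  function_space rho (ecsub f g).
Proof.
by move=> Xf Xg; apply: function_space_add => //; exact: function_space_scale.
Qed.

(** Iterating the quasi-triangle inequality costs one more factor C for each
    further term; the coefficients of the positive element below absorb these
    powers. *)
Lemma norm_plus_sum (C : R) n (u_ : nat -> T -> \bar R) : (0 <= C)%R ->
  (forall u v : T -> \bar R, Mplus u -> Mplus v ->
     norm_plus rho (fun x => u x + v x) <=
     C%:E * (norm_plus rho u + norm_plus rho v)) ->
  (forall k, Mplus (u_ k)) ->
  norm_plus rho (fun x => \sum_(k < n) u_ k x) <=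
  \sum_(k < n) (C ^+ k.+1)%:E * norm_plus rho (u_ k).
Proof.
move=> C0 triC; elim: n u_ => [|n IHn] u_ pu.
  under eq_fun do rewrite big_ord0; rewrite big_ord0.
  by rewrite -[X in X <= _]/(rho (cplx (fun=> 0%R))) rho_cplx0.
have N0 (v : T -> \bar R) : Mplus v -> 0 <= norm_plus rho v.
  by move=> pv; apply: (qbfn_ge0 rhoN); exact: Mfun_of_ereal.
under eq_fun do rewrite big_ord_recl.
apply: le_trans (triC _ _ (pu 0%N) _) _.
  split; last by move=> x; apply: sume_ge0 => k _; case: (pu (lift ord0 k)).
  by apply: emeasurable_sum => k; case: (pu (lift ord0 k)).
have -> : \sum_(k < n.+1) (C ^+ k.+1)%:E * norm_plus rho (u_ k) =
    C%:E * (norm_plus rho (u_ 0%N) +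
            \sum_(k < n) (C ^+ k.+1)%:E * norm_plus rho (u_ k.+1)).
  rewrite big_ord_recl /= expr1 ge0_muleDr.
  - congr (_ + _); rewrite ge0_sume_distrr.
      by apply: eq_bigr => k _; rewrite muleA -EFinM -exprS.
    by move=> k _; rewrite mule_ge0 ?N0 // lee_fin exprn_ge0.
  - exact: N0.
  - by apply: sume_ge0 => k _; rewrite mule_ge0 ?N0 // lee_fin exprn_ge0.
rewrite lee_wpmul2l ?lee_fin // leeD2l //.
exact: (IHn (fun k => u_ k.+1)).
Qed.

End norm_facts.

(** * A strictly positive element of X *)

Section positive_element.
Local Open Scope ereal_scope.
Context d (T : measurableType d) (R : realType).
Context (mu : {sigma_finite_measure set T -> \bar R}).
Context (rho : (T -> ecomplex R) -> \bar R).
Hypothesis rhoN : quasi_banach_function_norm mu rho.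

(** The function is the sum of the c_k 1_(F_k), where the F_k have finite measure
    and cover the space.  It replaces the constant 1, which need not have a finite
    norm: multiplication by w maps bounded measurable functions into X. *)
Lemma exists_positive_real_space :
  exists w : T -> R, real_space rho w /\ forall x, (0 < w x)%R.
Proof.
have [F FT mF] := sigma_finiteT mu.
have mF1 k : measurable (F k) by case: (mF k).
have [C C1 triC] := qbfn_triangle rhoN.
have C0 : (0 < C)%R by exact: lt_le_trans C1.
pose a k : \bar R := norm_plus rho (fun x => (\1_(F k) x)%:E).
have pind k : Mplus (fun x => (\1_(F k) x : R)%:E).
  by split => [|x]; [apply/measurable_EFinP|rewrite lee_fin].
have a0 k : 0 <= a k by apply: (qbfn_ge0 rhoN); exact: Mfun_of_ereal.
have afin k : a k \is a fin_num.
  by rewrite ge0_fin_numE //; apply: (qbfn_indic rhoN) => //; case: (mF k).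
(* The factor C ^+ k.+1 compensates norm_plus_sum, the factor 1 + fine (a k) the
   norm of the indicator, and 2 ^+ k.+1 makes both the series and the series of
   the norms converge, with sum at most 1. *)
pose c k : R := (C ^+ k.+1 * 2 ^+ k.+1 * (1 + fine (a k)))^-1%R.
have fa0 k : (0 <= fine (a k))%R by exact: fine_ge0.
have d0 k : (0 < C ^+ k.+1 * 2 ^+ k.+1 * (1 + fine (a k)))%R.
  by rewrite !mulr_gt0 ?exprn_gt0 // ltr_pwDl.
have c0 k : (0 < c k)%R by rewrite invr_gt0.
have cle k : (c k <= 2 ^- k.+1)%R.
  rewrite /c lef_pV2 ?posrE ?exprn_gt0 // -[leLHS]mul1r -[leLHS]mulr1.
  rewrite ler_pM ?mulr_ge0 ?exprn_ge0 // ?lerDl //.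
  by rewrite ler_wpM2r ?exprn_ge0 // exprn_ege1.
have ckle k : (C ^+ k.+1 * (c k * fine (a k)) <= 2 ^- k.+1)%R.
  have -> : (C ^+ k.+1 * (c k * fine (a k)) =
    2 ^- k.+1 * (fine (a k) / (1 + fine (a k))))%R.
    rewrite /c; field; rewrite ?expf_eq0 /= ?gt_eqF //; exact: ltr_pwDl.
  rewrite ler_piMr ?invr_ge0 ?exprn_ge0 // ler_pdivrMr ?mul1r ?lerDr //.
  exact: ltr_pwDl.
have geo n : (\sum_(k < n) 2 ^- k.+1 <= 1 :> R)%R.
  suff -> : (\sum_(k < n) 2 ^- k.+1 = 1 - 2 ^- n :> R)%R.
    by rewrite gerBl invr_ge0 exprn_ge0.
  elim: n => [|n IHn]; first by rewrite big_ord0 expr0 invr1 subrr.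
  rewrite big_ord_recr /= IHn; rewrite exprS invfM.
  have := @mulfV R 2; lra.
pose S n x : R := (\sum_(k < n) c k * \1_(F k) x)%R.
have t0 k x : (0 <= c k * \1_(F k) x)%R by rewrite mulr_ge0 // ltW.
have ndS x : nondecreasing_seq (S ^~ x).
  by apply/nondecreasing_seqP => n; rewrite /S big_ord_recr /= lerDl.
have S1 n x : (S n x <= 1)%R.
  apply: le_trans (geo n); apply: ler_sum => k _.
  apply: le_trans (cle k); rewrite ler_piMr ?(ltW (c0 _)) // indicE.
have cvS x : cvgn (S ^~ x).
  by apply: nondecreasing_is_cvgn => //; exists 1%R => _ [n _ <-].
pose w x := limn (S ^~ x).
have mS n : measurable_fun setT (S n).
  by apply: measurable_sum => k; apply: measurable_funM.
have mw : measurable_fun setT w.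
  by apply: (measurable_fun_cvg mS) => x _; exact: cvS.
have wpos x : (0 < w x)%R.
  have : [set: T] x by [].
  rewrite FT => -[k _ Fkx].
  apply: lt_le_trans (nondecreasing_cvgn_le (ndS x) (cvS x) k.+1).
  rewrite /S big_ord_recr /= ltr_wpDl ?sumr_ge0 //.
  by rewrite indicE mem_set // mulr1.
exists w; split => //; split => //.
have pS n : Mplus (fun x => (S n x)%:E).
  split => [|x]; first exact/measurable_EFinP.
  by rewrite lee_fin sumr_ge0.
have pw : Mplus (fun x => (w x)%:E).
  by split => [|x]; [exact/measurable_EFinP|rewrite lee_fin ltW].
have [_ cvN] : nondecreasing_seq (fun n => norm_plus rho (fun x => (S n x)%:E))
    /\ norm_plus rho (fun x => (S n x)%:E) @[n --> \oo] -->
       norm_plus rho (fun x => (w x)%:E).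
  apply: (qbfn_monotone rhoN) => //; apply: aeW => x; split.
    by move=> m n mn; rewrite lee_fin ndS.
  by apply: cvg_EFin; [exact: nearW|exact: cvS].
rewrite -[rho _]/(norm_plus rho (fun x => (w x)%:E)).
rewrite -(cvg_lim _ cvN) //; apply: (@le_lt_trans _ _ 1); last exact: ltry.
apply: lime_le; first by apply/cvg_ex; eexists; exact: cvN.
apply: nearW => n.
have := @norm_plus_sum _ _ _ mu rho rhoN C n (fun k x => (c k * \1_(F k) x)%:E).
under [X in norm_plus rho X]eq_fun do rewrite sumEFin.
move/(_ (ltW C0) triC _)/le_trans; apply.
  move=> k; split => [|x]; last by rewrite lee_fin.
  by apply/measurable_EFinP; apply: measurable_funM.
apply: (@le_trans _ _ (\sum_(k < n) (2 ^- k.+1)%:E)); last first.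
  by rewrite sumEFin lee_fin.
apply: lee_sum => k _.
rewrite -[norm_plus _ _]/(rho (cplx (fun x => c k * \1_(F k) x)%R)).
rewrite (rho_cplx_scale rhoN) ?gtr0_norm //.
rewrite -[rho _]/(a k) -(fineK (afin k)) -!EFinM lee_fin.
exact: ckle.
Qed.

End positive_element.

(** * Rearrangements and their pairing *)

Lemma cvge_lt T (F : set_system T) (FF : Filter F) (R : realType)
    (f : T -> \bar R) (l y : \bar R) :
  f @ F --> l -> (l < y)%E -> \forall t \near F, (f t < y)%E.
Proof. by move=> fl ly; exact: (fl _ (open_ereal_lt' ly)). Qed.

Lemma cvge0P (R : realType) (f : nat -> \bar R) : (forall n, 0 <= f n)%E ->
  (forall e : R, 0 < e -> \forall n \near \oo, (f n <= e%:E)%E) ->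
  f @ \oo --> (0 : \bar R)%E.
Proof.
move=> f0 fe; apply/fine_cvgP; split.
  apply: filterS (fe 1 ltr01) => n fn.
  by rewrite ge0_fin_numE //; apply: le_lt_trans fn _; exact: ltry.
apply/cvgrPdist_le => e e0; apply: filterS (fe e e0) => n fn.
rewrite sub0r normrN ger0_norm ?fine_ge0 //=.
by rewrite -lee_fin fineK // ge0_fin_numE //; apply: le_lt_trans fn (ltry _).
Qed.

Section rearrangement_facts.
Local Open Scope ereal_scope.
Context d (T : measurableType d) (R : realType).
Context (mu : {measure set T -> \bar R}).
Implicit Types (f g : T -> ecomplex R) (u v : T -> R).

Lemma measurable_superlevel f (s : \bar R) : Mfun f ->
  measurable [set x | s < ecabs (f x)].
Proof.
move=> mf; rewrite -[X in measurable X]setTI.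
by apply: emeasurable_fun_o_infty => //; exact: Mfun_ecabs.
Qed.

Lemma rearrangement_ge0 f t : 0 <= rearrangement mu f t.
Proof. by apply: le_ereal_inf_tmp => _ [s [s0 _] <-]; rewrite lee_fin. Qed.

Lemma rearrangement_nonincreasing f (s t : R) : (s <= t)%R ->
  rearrangement mu f t <= rearrangement mu f s.
Proof.
move=> st; apply: ereal_inf_le_tmp => _ [r [r0 fr] <-]; exists r => //.
by split => //; apply: le_trans fr _; rewrite lee_fin.
Qed.

Lemma rearrangement_le f g t : Mfun f -> Mfun g ->
  (forall x, ecabs (f x) <= ecabs (g x)) ->
  rearrangement mu f t <= rearrangement mu g t.
Proof.
move=> mf mg fg; apply: ereal_inf_le_tmp => _ [r [r0 fr] <-]; exists r => //.
split => //; apply: le_trans fr; apply: le_measure; rewrite ?inE.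
- exact: measurable_superlevel.
- exact: measurable_superlevel.
- by move=> x /= /lt_le_trans; apply.
Qed.

Lemma rearrangement_le_level f (s t : R) : (0 <= s)%R ->
  distribution_fun mu f s <= t%:E -> rearrangement mu f t <= s%:E.
Proof. by move=> s0 fs; apply: ereal_inf_lbound; exists s. Qed.

Lemma distribution_le_of_rearrangement_lt f (s t : R) : Mfun f ->
  rearrangement mu f t < s%:E -> distribution_fun mu f s <= t%:E.
Proof.
move=> mf /ereal_inf_lt[_ [r [r0 fr] <-] rs]; apply: le_trans fr.
apply: le_measure; rewrite ?inE; [exact: measurable_superlevel..|].
by move=> x /=; exact: lt_trans.
Qed.

(** The superlevel sets of a monotone function are intervals. *)
Lemma measurable_rearrangement f : measurable_fun setT (rearrangement mu f).
Proof.
apply: (measurability _ (ErealGenOInfty.measurableE R)) => // _ [_ [x ->] <-].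
rewrite setTI; apply: is_interval_measurable => s t /= _ + r /andP[_ rt].
rewrite !in_itv /= !andbT => xt; apply: lt_le_trans xt _.
exact: rearrangement_nonincreasing.
Qed.

Lemma pairingC f g :
  rearrangement_pairing mu f g = rearrangement_pairing mu g f.
Proof. by apply: eq_integral => t _; rewrite muleC. Qed.

Lemma pairing_ge0 f g : 0 <= rearrangement_pairing mu f g.
Proof.
by apply: integral_ge0 => t _; rewrite mule_ge0 // rearrangement_ge0.
Qed.

Lemma measurable_abs_mul f g : Mfun f -> Mfun g ->
  measurable_fun setT (fun x => ecabs (f x) * ecabs (g x)).
Proof. by move=> mf mg; apply: emeasurable_funM; exact: Mfun_ecabs. Qed.

Lemma abs_mul_ge0 f g x : 0 <= ecabs (f x) * ecabs (g x).
Proof. by rewrite mule_ge0 // ecabs_ge0. Qed.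

Section resonant_space.
Hypothesis res : resonant mu.

Lemma integral_le_pairing f g : Mfun f -> Mfun g ->
  \int[mu]_x (ecabs (f x) * ecabs (g x)) <= rearrangement_pairing mu f g.
Proof.
move=> mf mg; rewrite -(res mf mg).
by apply: ereal_sup_ubound; exists g.
Qed.

Lemma pairing_equimeasurable f g g' : equimeasurable mu g' g ->
  rearrangement_pairing mu f g' = rearrangement_pairing mu f g.
Proof.
move=> gg'; apply: eq_integral => t.
by rewrite inE /= in_itv /= andbT => t0; rewrite gg'.
Qed.

(** By resonance the left-hand side is the supremum over psi equimeasurable with
    phi of the integrals of |f + g| |psi|, and each of them splits. *)
Lemma pairing_add phi f g : Mfun phi -> Mfun f -> Mfun g ->
  rearrangement_pairing mu phi (fun x => ecadd (f x) (g x)) <=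
  rearrangement_pairing mu phi f + rearrangement_pairing mu phi g.
Proof.
move=> mphi mf mg; have mfg := Mfun_add mf mg.
rewrite pairingC -(res mfg mphi); apply: ge_ereal_sup => _ [psi [mpsi eq] <-].
apply: (@le_trans _ _ (\int[mu]_x (ecabs (f x) * ecabs (psi x) +
                                   ecabs (g x) * ecabs (psi x)))).
  apply: ge0_le_integral => //.
  - by move=> x _; rewrite mule_ge0 ?ecabs_ge0.
  - exact: measurable_abs_mul.
  - by apply: emeasurable_funD; exact: measurable_abs_mul.
  - move=> x _; rewrite -ge0_muleDl ?ecabs_ge0 //.
    by rewrite lee_wpmul2r ?ecabs_ge0 // ecabs_add.
rewrite ge0_integralD //; last 4 first.
- by move=> x _; exact: abs_mul_ge0.
- exact: measurable_abs_mul.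
- by move=> x _; exact: abs_mul_ge0.
- exact: measurable_abs_mul.
rewrite (pairingC phi f) (pairingC phi g).
rewrite -(pairing_equimeasurable f eq) -(pairing_equimeasurable g eq).
by apply: leeD; exact: integral_le_pairing.
Qed.

Section with_norm.
Context (rho : (T -> ecomplex R) -> \bar R).
Hypothesis rhoN : quasi_banach_function_norm mu rho.

(** Scaling g to norm 1 reduces this to the definition of the associate norm; if
    the norm of g is 0 then g vanishes almost everywhere. *)
Lemma associate_holder phi g : Mfun phi -> function_space rho g ->
  \int[mu]_x (ecabs (phi x) * ecabs (g x)) <= associate_norm mu rho phi * rho g.
Proof.
move=> mphi [mg rg]; have [r0|r0] := eqVneq (rho g) 0.
  rewrite r0 mule0 le_eqVlt; apply/orP; left; apply/eqP.
  rewrite -(@integral0 _ _ _ mu setT); apply: ge0_ae_eq_integral => //.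
  - exact: measurable_abs_mul.
  - by move=> x _; exact: abs_mul_ge0.
  - apply: filterS (rho_eq0 rhoN mg r0) => x /= -> _.
    by rewrite mule0.
have rge0 := qbfn_ge0 rhoN mg.
have rfin : rho g \is a fin_num by rewrite ge0_fin_numE.
have rpos : (0 < fine (rho g))%R by rewrite fine_gt0 // rg lt0e r0 rge0.
pose c : R[i] := ((fine (rho g))^-1)%:C%C.
have cE : ComplexField.Normc.normc c = (fine (rho g))^-1%R.
  by rewrite normc_real gtr0_norm // invr_gt0.
pose h x := ecmul (Some c) (g x).
have mh : Mfun h by apply: Mfun_mul => //; exact: Mfun_cst.
have rh : rho h <= 1.
  by rewrite /h (rho_scale rhoN) // cE -(fineK rfin) -EFinM mulVf // gt_eqF.
have : \int[mu]_x (ecabs (phi x) * ecabs (h x)) <= associate_norm mu rho phi.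
  by apply: ereal_sup_ubound; exists h.
under eq_integral do rewrite /h ecabs_mul muleCA.
rewrite ge0_integralZl //; last 3 first.
- exact: measurable_abs_mul.
- by move=> x _; exact: abs_mul_ge0.
- exact: ecabs_ge0.
rewrite (_ : ecabs (Some c) = (fine (rho g))^-1%:E); last by rewrite /ecabs cE.
move=> hle; rewrite -[X in _ <= _ * X](fineK rfin) -lee_pdivrMr // muleC.
exact: hle.
Qed.

Lemma associate_norm_ge0 phi : 0 <= associate_norm mu rho phi.
Proof.
apply: (@le_trans _ _ (\int[mu]_x (ecabs (phi x) * ecabs (cplx (fun=> 0%R) x)))).
  by apply: integral_ge0 => x _; exact: abs_mul_ge0.
apply: ereal_sup_ubound; exists (cplx (fun=> 0%R)) => //; split.
  exact: cplx_Mfun.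
by rewrite (rho_cplx0 rhoN).
Qed.

Hypothesis ri : rearrangement_invariant mu rho.

(** By resonance the pairing is a supremum over functions equimeasurable with g,
    all of the same norm as g. *)
Lemma pairing_le_norm phi g : Mfun phi -> function_space rho g ->
  rearrangement_pairing mu phi g <= associate_norm mu rho phi * rho g.
Proof.
move=> mphi [mg rg]; rewrite -(res mphi mg).
apply: ge_ereal_sup => _ [h [mh hg] <-].
rewrite -(ri mh mg hg); apply: associate_holder => //; split => //.
by rewrite (ri mh mg hg).
Qed.

Lemma pairing_lty phi g : associate_space mu rho phi -> function_space rho g ->
  rearrangement_pairing mu phi g < +oo.
Proof.
move=> [mphi phioo] Xg; apply: le_lt_trans (pairing_le_norm mphi Xg) _.
have [mg rg] := Xg; apply: lte_mul_pinfty => //.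
  exact: associate_norm_ge0.
by rewrite ge0_fin_numE // associate_norm_ge0.
Qed.

Hypothesis acr : ACR mu rho.

(** The only use of (ACR): it makes the set where v 0 > e of finite measure,
    without which the measures of the decreasing sets where v n > e, whose
    intersection is empty, need not tend to 0. *)
Lemma rearrangement_cvg0 (v : nat -> T -> R) (t : R) : (0 < t)%R ->
  real_space rho (v 0%N) -> (forall n, measurable_fun setT (v n)) ->
  (forall n x, 0 <= v n x)%R -> (forall x, nonincreasing_seq (v ^~ x)) ->
  (forall x, v n x @[n --> \oo] --> (0%R : R)) ->
  rearrangement mu (cplx (v n)) t @[n --> \oo] --> 0.
Proof.
move=> t0 Xv mv v0 niv cv; apply: cvge0P => [n|e e0].
  exact: rearrangement_ge0.
pose F n := [set x | e%:E < ecabs (cplx (v n) x)].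
have mF n : measurable (F n).
  by apply: measurable_superlevel; exact: cplx_Mfun.
have FE n x : F n x = (e < v n x)%R.
  rewrite -[LHS]/(is_true (e%:E < ecabs (cplx (v n) x))).
  by rewrite ecabs_cplx lte_fin ger0_norm.
have F0 : mu (F 0%N) < +oo.
  have eE0 : 0 < e%:E by [].
  have /cvge_lt /(_ eE0) : rearrangement mu (cplx (v 0%N)) s
      @[s --> +oo%R] --> 0 by apply: acr; exact: cplx_function_space.
  move=> [M [_ FM]].
  apply: (@le_lt_trans _ _ (M + 1)%:E); last exact: ltry.
  apply: distribution_le_of_rearrangement_lt; first exact: cplx_Mfun.
  by apply: FM; rewrite ltrDl.
have F_cap : \bigcap_n F n = set0.
  rewrite -subset0 => x Fx.
  have /cvgr_lt /(_ e e0) [N _ /(_ N (leqnn N))] := cv x.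
  by have := Fx N I; rewrite FE => /lt_trans/[apply]; rewrite ltxx.
have cF : mu (F n) @[n --> \oo] --> 0.
  rewrite -(measure0 mu) -F_cap; apply: nonincreasing_cvg_mu => //.
    by rewrite F_cap.
  move=> m n mn; apply/subsetPset => x; rewrite !FE => /lt_le_trans; apply.
  exact: niv.
have : \forall n \near \oo, mu (F n) < t%:E by apply: cvge_lt cF _.
apply: filterS => n /ltW Fn; apply: rearrangement_le_level => //.
exact: ltW.
Qed.

(** Order continuity of the seminorms: dominated convergence on the half-line,
    with the integrable bound phi^* (v 0)^*. *)
Lemma pairing_cvg0 phi (v : nat -> T -> R) : associate_space mu rho phi ->
  real_space rho (v 0%N) -> (forall n, measurable_fun setT (v n)) ->
  (forall n x, 0 <= v n x)%R -> (forall x, nonincreasing_seq (v ^~ x)) ->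
  (forall x, v n x @[n --> \oo] --> (0%R : R)) ->
  rearrangement_pairing mu phi (cplx (v n)) @[n --> \oo] --> 0.
Proof.
move=> Xphi Xv mv v0 niv cv.
pose g t := rearrangement mu phi t * rearrangement mu (cplx (v 0%N)) t.
have mr := measurable_rearrangement.
have D0 : measurable (`[0%R, +oo[%classic : set (measurableTypeR R)).
  exact: measurable_itv.
have g0 t : 0 <= g t by rewrite mule_ge0 // rearrangement_ge0.
have v_le n t : rearrangement mu (cplx (v n)) t <=
    rearrangement mu (cplx (v 0%N)) t.
  apply: rearrangement_le; [exact: cplx_Mfun..|move=> x].
  by rewrite !ecabs_cplx lee_fin !ger0_norm //; exact: niv.
have ig : (@lebesgue_measure R).-integrable `[0%R, +oo[ g.
  apply/integrableP; split.
    by apply: emeasurable_funM; apply: measurable_funTS; exact: mr.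
  under eq_integral do rewrite gee0_abs //.
  by apply: pairing_lty => //; exact: cplx_function_space.
rewrite -(@integral0 _ _ _ (@lebesgue_measure R) `[0%R, +oo[%classic).
have pos_ae : {ae @lebesgue_measure R,
    forall t : measurableTypeR R, t <> 0%R :> R}.
  exists [set 0%R]; split => //; first exact: lebesgue_measure_set1.
  by move=> t /= /contrapT.
have [] // := @dominated_convergence _ _ _ (@lebesgue_measure R) `[0%R, +oo[ D0
  (fun n t => rearrangement mu phi t * rearrangement mu (cplx (v n)) t)
  (cst 0) g.
- by move=> n; apply: emeasurable_funM; apply: measurable_funTS; exact: mr.
- have := integrable_ae D0 ig; move: pos_ae; apply: filterS2 => t t0 gfin tD.
  have {t0} tpos : (0 < t)%R.
    move: tD; rewrite /= in_itv /= andbT lt0r => ->.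
    by rewrite andbT; apply/eqP.
  have := gfin tD; rewrite /g.
  have := rearrangement_ge0 phi t.
  case: (rearrangement mu phi t) => [r _ _|_|//].
    rewrite -[0 in X in _ --> X](mule0 r%:E); apply: cvgeZl => //.
    exact: rearrangement_cvg0.
  (* Where phi^* is infinite, integrability of the bound forces (v 0)^*, hence
     every (v n)^*, to vanish. *)
  have := rearrangement_ge0 (cplx (v 0%N)) t.
  rewrite le_eqVlt => /predU1P[h _|h].
    rewrite (_ : (fun n => _) = cst 0); first exact: cvg_cst.
    apply/funext => n; apply/eqP.
    have : rearrangement mu (cplx (v n)) t <= 0 by rewrite h.
    rewrite le_eqVlt ltNge rearrangement_ge0 orbF => /eqP ->.
    by rewrite mule0.
  by rewrite gt0_mulye.
- apply: aeW => t n _; rewrite gee0_abs ?mule_ge0 ?rearrangement_ge0 //.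
  by rewrite lee_wpmul2l ?rearrangement_ge0.
Qed.
End with_norm.
End resonant_space.
End rearrangement_facts.

(** * The topology xi *)

Lemma nbhs_complexP (R : realType) (c : R[i]^o) (U : set R[i]^o) :
  nbhs c U <-> exists2 e : R, 0 < e &
    forall z : R[i], ComplexField.Normc.normc (z - c) < e -> U z.
Proof.
have nE (z : R[i]) : `|z| = (ComplexField.Normc.normc z)%:C%C by [].
split.
  case/nbhs_normP => e; rewrite /= => e0 eU.
  have eR : e = (complex.Re e)%:C%C by rewrite RRe_real // gtr0_real.
  exists (complex.Re e); first by rewrite -ltcR -eR.
  by move=> z zc; apply: eU => /=; rewrite distrC nE eR ltcR.
case=> e e0 eU; apply: (proj2 (nbhs_normP c U)).
exists e%:C%C; first by rewrite /= ltcR.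
by move=> z /=; rewrite distrC nE ltcR => /eU.
Qed.

Section xi_topology_facts.
Context d (T : measurableType d) (R : realType).
Context (mu : {measure set T -> \bar R}) (rho : (T -> ecomplex R) -> \bar R).
Local Notation X := (xi_space mu rho).
Local Notation normc := ComplexField.Normc.normc.

Lemma xi_ball_nbhs phi (f g : X) (e : R) : associate_space mu rho phi ->
  0 < e -> @xi_ball _ _ _ mu rho phi f e g -> nbhs g (xi_ball phi f e).
Proof.
move=> Xphi e0 fg; exists (xi_ball phi f e); split => //.
exists [set xi_ball phi f e]; last by rewrite bigcup_set1.
move=> A ->; exists (fset1 (xi_ball phi f e)).
  by move=> B /fset1P ->; apply/mem_set; exists phi, f, e.
by rewrite set_fset1 bigcap_set1.
Qed.

Lemma xi_cvg (F : set_system X) (FF : Filter F) (g : X) :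
  (forall phi (f : X) e, associate_space mu rho phi -> 0 < e ->
     @xi_ball _ _ _ mu rho phi f e g -> F (xi_ball phi f e)) -> F --> g.
Proof.
move=> Fg A [_ [[B sB <-] [C BC Cg] sUBA]].
rewrite nbhs_filterE; apply: filterS sUBA _; apply: (@filterS _ _ _ C).
  by move=> ? ?; exists C.
have /sB [D sD IDeC] := BC; rewrite -IDeC; apply: filter_bigI => E DE.
have /sD := DE; move=> /set_mem [phi [f [e [Xphi e0 EE]]]].
rewrite EE; apply: Fg => //.
by move: Cg; rewrite -IDeC => /(_ _ DE); rewrite EE.
Qed.

Lemma xi_ballE phi (f g : X) (e : R) : @xi_ball _ _ _ mu rho phi f e g =
  (rearrangement_pairing mu phi (ecsub (sval g) (sval f)) < e%:E)%E :> Prop.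
Proof. by []. Qed.

Hypothesis rhoN : quasi_banach_function_norm mu rho.

Definition zeroX : X :=
  exist _ (cplx (fun=> 0)) (cplx_function_space (real_space0 rhoN)).

Section functional.
Variable alpha : X -> R[i]^o.
Hypothesis alphaL : linear_functional alpha.

(** The three functions in the linearity of alpha may be the same f, as
    f = 1 f + f almost everywhere. *)
Lemma linear_functional_ae_eq0 (f : X) :
  {ae mu, forall x, sval f x = Some (0%:C)%C} -> alpha f = 0.
Proof.
move=> f0; have : alpha f = 1 * alpha f + alpha f.
  apply: alphaL; apply: filterS f0 => x ->; rewrite ecaddC ecadd0l.
  by rewrite /ecmul -[(0%:C)%C]/(0 : R[i]) mulr0.
by rewrite mul1r => /eqP; rewrite -subr_eq0 opprD addNKr oppr_eq0 => /eqP.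
Qed.

Lemma linear_functional0 : alpha zeroX = 0.
Proof. by apply: linear_functional_ae_eq0; exact: aeW. Qed.

Lemma linear_functionalZ (a : R[i]) (f h : X) :
  (forall x, sval h x = ecmul (Some a) (sval f x)) -> alpha h = a * alpha f.
Proof.
move=> hf; rewrite (alphaL (a := a) (f := f) (g := zeroX)).
  by rewrite linear_functional0 addr0.
by apply: aeW => x; rewrite hf ecaddC ecadd0l.
Qed.

Hypothesis alphaC : continuous alpha.
Hypothesis res : resonant mu.
Hypothesis ri : rearrangement_invariant mu rho.

(** The subbasic balls around arbitrary centres f that contain 0 are the issue:
    by the triangle inequality, such a ball contains a ball of the same seminorm
    around 0, of radius r - [0 - f|phi]. *)
Lemma xi_continuous_cvg0 (h : nat -> X) :
  (forall phi, associate_space mu rho phi ->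
    (rearrangement_pairing mu phi (sval (h n)) @[n --> \oo] --> 0)%E) ->
  forall e : R, 0 < e -> \forall n \near \oo, normc (alpha (h n)) < e.
Proof.
move=> h0 e e0.
have : h @ \oo --> zeroX.
  apply: xi_cvg => phi f r Xphi r0.
  rewrite xi_ballE; set m := ecsub _ _ => mr.
  have [mphi _] := Xphi; have [mf _] := svalP f.
  have mm : Mfun m.
    apply: Mfun_add; first exact: cplx_Mfun.
    by apply: Mfun_mul => //; exact: Mfun_cst.
  have mfin : rearrangement_pairing mu phi m \is a fin_num.
    by rewrite ge0_fin_numE ?pairing_ge0 // (lt_trans mr) // ltry.
  have : (0 < r%:E - rearrangement_pairing mu phi m)%E by rewrite sube_gt0.
  move/(cvge_lt _ (h0 _ Xphi)); apply: filterS => n hn.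
  suff : xi_ball phi f r (h n) by []; rewrite xi_ballE.
  have -> : ecsub (sval (h n)) (sval f) = fun x => ecadd (sval (h n) x) (m x).
    by apply/funext => x; rewrite /m /ecsub ecadd0l.
  have [mh _] := svalP (h n).
  apply: le_lt_trans (pairing_add res mphi mh mm) _.
  by rewrite -lteBrDr.
move=> hz; have := @cvg_comp _ _ _ h alpha _ _ _ hz (@alphaC zeroX).
move=> /(_ [set z : R[i]^o | normc z < e]); apply.
apply/nbhs_complexP; exists e => // z.
by rewrite linear_functional0 subr0.
Qed.

(** Otherwise some h n in the unit ball have |alpha (h n)| > n + 1; but
    k n = h n / (n + 1) tends to 0 for xi, each seminorm being bounded by a
    multiple of the norm. *)
Lemma xi_continuous_bounded : exists K : R,
  forall h : X, (rho (sval h) <= 1)%E -> normc (alpha h) <= K.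
Proof.
apply: contrapT => noK.
have /choice [h hP] : forall n : nat, exists h : X,
    (rho (sval h) <= 1)%E /\ n.+1%:R < normc (alpha h).
  move=> n; apply: contrapT => nh; apply: noK; exists n.+1%:R => h h1.
  by rewrite leNgt; apply/negP => hn; apply: nh; exists h.
pose c n : R[i] := (n.+1%:R^-1 : R)%:C%C.
have nc n : normc (c n) = n.+1%:R^-1.
  by rewrite normc_real ger0_norm // invr_ge0.
pose k n : X := exist _ _ (function_space_scale rhoN (c n) (svalP (h n))).
have kE n : alpha (k n) = c n * alpha (h n) by exact: linear_functionalZ.
have k0 phi : associate_space mu rho phi ->
    (rearrangement_pairing mu phi (sval (k n)) @[n --> \oo] --> 0)%E.
  move=> [mphi phioo].
  have phi0 := associate_norm_ge0 rhoN phi.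
  have phifin : associate_norm mu rho phi \is a fin_num.
    by rewrite ge0_fin_numE.
  apply: (@squeeze_cvge _ _ _ _ (cst 0%E) _
     (fun n => (associate_norm mu rho phi * (n.+1%:R^-1)%:E)%E)).
  - apply: nearW => n; rewrite pairing_ge0 /=.
    apply: le_trans (pairing_le_norm res rhoN ri mphi (svalP (k n))) _.
    rewrite lee_wpmul2l //.
    have [mh _] := svalP (h n).
    rewrite (rho_scale rhoN) // nc.
    have [h1 _] := hP n.
    by rewrite -[leRHS]mule1 lee_wpmul2l // lee_fin invr_ge0.
  - exact: cvg_cst.
  - rewrite -(mule0 (associate_norm mu rho phi)); apply: cvgeZl => //.
    apply: cvg_EFin; first exact: nearW.
    exact: cvg_harmonic.
have [N _ /(_ N (leqnn N))] := xi_continuous_cvg0 k0 ltr01.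
rewrite /= kE ComplexField.Normc.normcM nc.
have [_ hN] := hP N.
by rewrite mulrC ltr_pdivrMr // mul1r => /lt_trans/(_ hN); rewrite ltxx.
Qed.

End functional.
End xi_topology_facts.

(** * Representation of order continuous real functionals *)

Import HBNNSimple.

Section real_representation.
Local Open Scope ereal_scope.
Context d (T : measurableType d) (R : realType).
Context (mu : {sigma_finite_measure set T -> \bar R}).
Context (rho : (T -> ecomplex R) -> \bar R).
Hypothesis rhoN : quasi_banach_function_norm mu rho.
Local Notation XR := (real_space rho).

Variable beta : (T -> R) -> R.
Hypothesis betaL : forall (a : R) u v, XR u -> XR v ->
  beta (fun x => a * u x + v x)%R = (a * beta u + beta v)%R.
Hypothesis betaN : forall u, XR u -> {ae mu, forall x, u x = 0%R} ->
  beta u = 0%R.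
Hypothesis betaS : forall v : nat -> T -> R, XR (v 0%N) ->
  (forall n, measurable_fun setT (v n)) ->
  (forall n x, 0 <= v n x)%R -> (forall x, nonincreasing_seq (v ^~ x)) ->
  (forall x, v n x @[n --> \oo] --> (0%R : R)) ->
  beta (v n) @[n --> \oo] --> (0%R : R).
Variable K : R.
Hypothesis betaB : forall u, XR u -> rho (cplx u) <= 1 -> (`|beta u| <= K)%R.

Lemma functional0 : beta (fun=> 0%R) = 0%R.
Proof. by apply: betaN; [exact: (real_space0 rhoN)|exact: aeW]. Qed.

Lemma functionalD u v : XR u -> XR v ->
  beta (fun x => u x + v x)%R = (beta u + beta v)%R.
Proof.
move=> Xu Xv; have := betaL 1 Xu Xv.
by under eq_fun do rewrite mul1r; rewrite mul1r.
Qed.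

Section weight.
Variable w : T -> R.
Hypothesis Xw : XR w.
Hypothesis w0 : forall x, (0 < w x)%R.

Lemma real_space_weighted_indic A : measurable A -> XR (fun x => w x * \1_A x)%R.
Proof.
move=> mA; apply: (real_space_le rhoN Xw).
  by apply: measurable_funM; [case: Xw|exact: measurable_indic].
move=> x; rewrite normrM ler_piMr // indicE.
by case: (x \in A); rewrite ?normr1 ?normr0.
Qed.

Definition weighted_charge (A : set T) : \bar R :=
  (beta (fun x => w x * \1_A x)%R)%:E.

(** The remainder of the series after n terms is the value at the union G n of the
    later sets, and the w 1_(G n) decrease to 0 pointwise. *)
Lemma weighted_charge_sigma_additive : semi_sigma_additive weighted_charge.
Proof.
move=> F mF tF mUF.
pose G n := \bigcup_(i in [set i | (n <= i)%N]) F i.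
have mG n : measurable (G n) by apply: bigcup_measurable => k _.
have GS n : G n = F n `|` G n.+1.
  rewrite /G; apply/seteqP; split => [x [i /= ni Fix]|x [Fnx|[i /= ni Fix]]].
  - move: ni; rewrite leq_eqVlt => /predU1P[->|ni]; first by left.
    by right; exists i.
  - by exists n => /=.
  - by exists i => //=; exact: ltnW.
have disj n x : F n x -> ~ G n.+1 x.
  move=> Fnx [i /= ni Fix]; have : n = i by apply: (tF n i I I); exists x.
  by move=> ni'; move: ni; rewrite ni' ltnn.
have indS n x : \1_(G n) x = (\1_(F n) x + \1_(G n.+1) x)%R :> R.
  rewrite !indicE GS in_setU.
  have [Fx|nFx] := pselect (F n x).
    by rewrite (mem_set Fx) (memNset (@disj _ _ Fx)) addr0.
  by rewrite (memNset nFx) add0r.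
have GE n : beta (fun x => w x * \1_(G 0%N) x)%R =
   (\sum_(0 <= i < n) beta (fun x => w x * \1_(F i) x) +
    beta (fun x => w x * \1_(G n) x))%R.
  elim: n => [|n IHn]; first by rewrite big_nil add0r.
  rewrite big_nat_recr //= -addrA.
  rewrite -functionalD; [|exact: real_space_weighted_indic..].
  rewrite IHn; congr (_ + beta _)%R; apply/funext => x.
  by rewrite -mulrDr -indS.
have cv0 : beta (fun x => w x * \1_(G n) x)%R @[n --> \oo] --> (0%R : R).
  apply: betaS.
  - exact: real_space_weighted_indic.
  - by move=> n; case: (real_space_weighted_indic (mG n)).
  - by move=> n x; rewrite mulr_ge0 // ltW.
  - move=> x; apply/nonincreasing_seqP => n.
    by apply: ler_wpM2l; [exact: ltW|rewrite (indS n) lerDr].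
  - move=> x; rewrite -[0%R in X in _ --> X](mulr0 (w x)).
    apply: cvgMr; apply: cvg_near_cst.
    have [[i Fix]|nF] := pselect (exists i, F i x).
      exists i.+1 => // n /= ni; rewrite indicE memNset // => -[j /= nj Fjx].
      have ij : i = j by apply: (tF i j I I); exists x.
      by move: (leq_trans ni nj); rewrite ij ltnn.
    apply: nearW => n; rewrite indicE memNset // => -[j _ Fjx].
    by apply: nF; exists j.
have G0 : G 0%N = \bigcup_n F n by apply: eq_bigcupl; split.
rewrite /weighted_charge -G0.
under eq_fun do rewrite sumEFin.
apply: cvg_EFin; first exact: nearW.
rewrite (_ : fine \o _ = (fun n => beta (fun x => w x * \1_(G 0%N) x)%R -
   beta (fun x => w x * \1_(G n) x)%R)%R); last first.
  by apply/funext => n /=; rewrite (GE n) addrK.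
rewrite -[X in _ --> X]subr0; apply: cvgB => //; exact: cvg_cst.
Qed.

Lemma weighted_charge0 : weighted_charge set0 = 0.
Proof.
rewrite /weighted_charge; under eq_fun do rewrite indic0 mulr0.
by rewrite functional0.
Qed.

Lemma exists_density : exists D : T -> R,
  mu.-integrable setT (EFin \o D) /\
  forall A, measurable A ->
    (beta (fun x => w x * \1_A x)%R)%:E = \int[mu]_(x in A) (D x)%:E.
Proof.
pose nu : {charge set T -> \bar R} :=
  HB.pack_for (charge T R) weighted_charge
    (isCharge.Build _ T R weighted_charge weighted_charge0
      (fun A _ => erefl) weighted_charge_sigma_additive).
have numu : nu `<< mu.
  apply/null_content_dominatesP => A mA A0.
  rewrite -[LHS]/(weighted_charge A) /weighted_charge betaN //.
    exact: real_space_weighted_indic.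
  exists A; split => // x /= h; apply: contrapT => nAx; apply: h.
  by rewrite indicE memNset // mulr0.
have fin x := @Radon_Nikodym_fin_num _ _ _ nu mu x numu.
have DE : EFin \o (fun x => fine (Radon_Nikodym nu mu x)) = Radon_Nikodym nu mu.
  by apply/funext => x /=; rewrite fineK.
exists (fun x => fine (Radon_Nikodym nu mu x)); split.
  by rewrite DE; exact: Radon_Nikodym_integrable.
move=> A mA; rewrite -[LHS]/(nu A) (Radon_Nikodym_integral numu mA).
by apply: eq_integral => x _; rewrite fineK.
Qed.

Section density.
Variable D : T -> R.
Hypothesis iD : mu.-integrable setT (EFin \o D).
Hypothesis DE : forall A, measurable A ->
  (beta (fun x => w x * \1_A x)%R)%:E = \int[mu]_(x in A) (D x)%:E.

Let mD : measurable_fun setT D.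
Proof. by apply/measurable_EFinP; exact: measurable_int iD. Qed.

(** The representation formula for the element w u of X, together with the
    conditions that give both of its sides a meaning. *)
Definition represented (u : T -> R) : Prop :=
  [/\ XR (fun x => w x * u x)%R,
      mu.-integrable setT (fun x => (D x * u x)%:E) &
      (beta (fun x => w x * u x)%R)%:E = \int[mu]_x (D x * u x)%:E].

Lemma represented_lin a u v : represented u -> represented v ->
  represented (fun x => a * u x + v x)%R.
Proof.
move=> [Xu iu ue] [Xv iv ve].
have E1 : (fun x => w x * (a * u x + v x))%R =
    (fun x => a * (w x * u x) + w x * v x)%R by apply/funext => x; ring.
have E2 : (fun x => (D x * (a * u x + v x))%:E) =
    (fun x => a%:E * (D x * u x)%:E + (D x * v x)%:E).
  by apply/funext => x; rewrite -EFinM -EFinD; congr EFin; ring.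
have iau := integrableZl measurableT a iu.
split.
- rewrite E1; apply: (real_space_add rhoN) => //.
  exact: (real_space_scale rhoN).
- by rewrite E2; exact: integrableD.
- by rewrite E1 betaL // E2 integralD // integralZl // -ue -ve -EFinM -EFinD.
Qed.

Lemma represented0 : represented (fun=> 0%R).
Proof.
have E1 : (fun x => w x * 0)%R = (fun=> 0%R).
  by apply/funext => x; rewrite mulr0.
have E2 : (fun x => (D x * 0)%:E) = (cst 0).
  by apply/funext => x; rewrite mulr0.
split; rewrite ?E1 ?E2.
- exact: (real_space0 rhoN).
- exact: integrable0.
- by rewrite functional0 integral0.
Qed.

Lemma represented_indic A : measurable A -> represented \1_A.
Proof.
move=> mA; split; first exact: real_space_weighted_indic.
- apply: (@le_integrable _ _ _ _ _ measurableT _ (EFin \o D)) => //.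
    by apply/measurable_EFinP; apply: measurable_funM.
  move=> x _; rewrite /= lee_fin normrM ler_piMr // indicE.
  by case: (x \in A); rewrite ?normr1 ?normr0.
- rewrite DE // integral_mkcond; apply: eq_integral => x _.
  rewrite patchE indicE; case: ifP => _; by rewrite ?mulr1 ?mulr0.
Qed.

Lemma represented_sum (s : seq R) (A : R -> set T) :
  (forall y, measurable (A y)) ->
  represented (fun x => \sum_(y <- s) y * \1_(A y) x)%R.
Proof.
move=> mA; elim: s => [|y s IHs].
  by under eq_fun do rewrite big_nil; exact: represented0.
under eq_fun do rewrite big_cons.
by apply: represented_lin => //; exact: represented_indic.
Qed.

(** The set P serves to change the sign of s where D is negative. *)
Lemma represented_simple (s : {nnsfun T >-> R}) (P : set T) : measurable P ->
  represented (fun x => s x * \1_P x)%R.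
Proof.
move=> mP.
rewrite (_ : (fun x => _) = (fun x => \sum_(y <- fset_set (range s))
    y * \1_(s @^-1` [set y] `&` P) x)%R).
  by apply: represented_sum => y; apply: measurableI.
apply/funext => x; rewrite fimfunE fsbig_finite //= mulr_suml.
by apply: eq_bigr => y _; rewrite indicI mulrA.
Qed.

Definition density_ratio x : R := (D x / w x)%R.

Let measurable_div (u : T -> R) : measurable_fun setT u ->
  measurable_fun setT (fun x => u x / w x)%R.
Proof.
move=> mu'; apply: measurable_funM => //.
have -> : (fun x => (w x)^-1%R) = (fun x => w x `^ (-1))%R.
  by apply/funext => x; rewrite powR_inv1 // ltW.
rewrite -[X in measurable_fun _ X]/((@powR R ^~ (-1)%R) \o w).
by apply: measurableT_comp; [exact: measurable_powR|case: Xw].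
Qed.

Lemma measurable_density_ratio : measurable_fun setT density_ratio.
Proof. exact: measurable_div. Qed.

Section approximation.
Variable u : T -> R.
Hypothesis Xu : XR u.
Hypothesis u0 : forall x, (0 <= u x)%R.

Let g x := (u x / w x)%R.

Let mg : measurable_fun setT (EFin \o g).
Proof. by apply/measurable_EFinP; apply: measurable_div; case: Xu. Qed.

Let s := nnsfun_approx measurableT mg.

Let wg x : (w x * g x)%R = u x.
Proof. by rewrite /g mulrCA mulfV ?mulr1 // gt_eqF. Qed.

Let g0 x : (0 <= g x)%R.
Proof. by rewrite divr_ge0 // ltW. Qed.

Let Dg x : (D x * g x)%R = (density_ratio x * u x)%R.
Proof. by rewrite /g /density_ratio mulrA mulrAC. Qed.

Let s_cvg x : s n x @[n --> \oo] --> g x.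
Proof.
have : EFin \o s ^~ x @ \oo --> (g x)%:E.
  by apply: cvg_nnsfun_approx => // y _; rewrite lee_fin.
by move/fine_cvg.
Qed.

Let s_nd x : nondecreasing_seq (fun n => s n x).
Proof. by move=> m n mn; exact/lefP/nd_nnsfun_approx. Qed.

Let s_le n x : (s n x <= g x)%R.
Proof.
rewrite -(cvg_lim _ (@s_cvg x)) //; apply: nondecreasing_cvgn_le => //.
by apply/cvg_ex; exists (g x).
Qed.

Let Xws n : XR (fun x => w x * s n x)%R.
Proof.
apply: (real_space_le rhoN Xu).
  by apply: measurable_funM => //; case: Xw.
move=> x; rewrite !ger0_norm //; last by rewrite mulr_ge0 // ltW.
by rewrite -(wg x) ler_wpM2l // ltW.
Qed.

(** The function t n = s n sgn D satisfies D t n = |D| s n, and w t n is dominated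
    by u; so the bound of beta on the unit ball bounds the integrals of |D| s n,
    which increase to the integral in question. *)
Lemma integral_density_le : rho (cplx u) <= 1 ->
  \int[mu]_x `|density_ratio x * u x|%:E <= K%:E.
Proof.
move=> u1.
pose P := [set x | (0 <= D x)%R].
have mP : measurable P.
  rewrite -[P]setTI; have := @measurable_fun_le _ _ _ setT (cst 0%R) D.
  by apply => //; exact: measurable_cst.
pose t n x := (-1 * (s n x * \1_(~` P) x) + s n x * \1_P x)%R.
have tE n x : (D x * t n x)%R = (`|D x| * s n x)%R.
  rewrite /t !indicE in_setC; have [Px|nPx] := pselect (P x).
    by rewrite (mem_set Px) /= ger0_norm //; ring.
  rewrite (memNset nPx) /= ltr0_norm; last by rewrite ltNge; apply/negP.
  by ring.
have ts n x : `|t n x|%R = s n x.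
  rewrite /t !indicE in_setC; case: (x \in P) => /=.
    by rewrite mulr0 mulr0 add0r mulr1 ger0_norm.
  by rewrite mulr0 addr0 mulr1 mulN1r normrN ger0_norm.
have rt n : represented (t n).
  by apply: represented_lin; apply: represented_simple => //; exact: measurableC.
have intK n : \int[mu]_x (`|D x| * s n x)%:E <= K%:E.
  have [Xwt _] := rt n.
  under eq_integral do rewrite tE.
  move=> <-; rewrite lee_fin (le_trans (ler_norm _)) //; apply: betaB => //.
  apply: le_trans u1; apply: (rho_le rhoN).
  - by apply: cplx_Mfun; case: Xwt.
  - by apply: cplx_Mfun; case: Xu.
  - apply: aeW => x; rewrite !ecabs_cplx lee_fin normrM ts.
    by rewrite gtr0_norm // ger0_norm // -(wg x) ler_wpM2l // ltW.
have limE x :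
    limn (fun n => (`|D x| * s n x)%:E) = `|density_ratio x * u x|%:E.
  apply/cvg_lim => //; apply: cvg_EFin; first exact: nearW.
  by rewrite -Dg normrM (ger0_norm (g0 _)); apply: cvgMr; exact: s_cvg.
have nd x : nondecreasing_seq (fun n => (`|D x| * s n x)%:E).
  by move=> m n mn; rewrite lee_fin ler_wpM2l //; exact: s_nd.
have ms n : measurable_fun setT (fun x => (`|D x| * s n x)%:E).
  apply/measurable_EFinP; apply: measurable_funM => //.
  exact: measurableT_comp.
have s0 n x : 0 <= (`|D x| * s n x)%:E by rewrite lee_fin mulr_ge0.
under eq_integral do rewrite -limE.
rewrite monotone_convergence //.
apply: lime_le; last exact: nearW.
apply: ereal_nondecreasing_is_cvgn => m n mn; apply: ge0_le_integral => //.
by move=> x _; exact: nd.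
Qed.

(** Both sides are limits along w s n: beta because u - w s n decreases to 0, the
    integral by dominated convergence. *)
Lemma represented_nonneg :
  mu.-integrable setT (fun x => (density_ratio x * u x)%:E) ->
  (beta u)%:E = \int[mu]_x (density_ratio x * u x)%:E.
Proof.
move=> iu.
have ms n : represented (s n).
  have := represented_simple (s n) measurableT.
  by under eq_fun do rewrite indicT mulr1.
pose v n x := (u x - w x * s n x)%R.
have v0 n x : (0 <= v n x)%R.
  by rewrite subr_ge0 -(wg x) ler_wpM2l // ltW.
have Xv n : XR (v n).
  apply: (real_space_le rhoN Xu).
    by apply: measurable_funB; [case: Xu|case: (Xws n)].
  by move=> x; rewrite !ger0_norm // gerBl mulr_ge0 // ltW.
have cv : beta (v n) @[n --> \oo] --> (0%R : R).
  apply: betaS => //.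
  - by move=> n; case: (Xv n).
  - move=> x m n mn; rewrite /v; apply: lerB => //.
    by apply: ler_wpM2l; [exact: ltW|exact: s_nd].
  - move=> x; rewrite -[0%R in X in _ --> X](subrr (u x)).
    apply: cvgB; first exact: cvg_cst.
    by rewrite -(wg x); apply: cvgMr; exact: s_cvg.
have bE n : (beta u - beta (v n) = beta (fun x => w x * s n x))%R.
  apply/eqP; rewrite subr_eq -functionalD //; apply/eqP; congr beta.
  by apply/funext => x; rewrite /v addrC subrK.
have c1 : (beta (fun x => w x * s n x)%R)%:E @[n --> \oo] --> (beta u)%:E.
  apply: cvg_EFin; first exact: nearW.
  rewrite (_ : fine \o _ = (fun n => beta u - beta (v n))%R); last first.
    by apply/funext => n /=; rewrite bE.
  by rewrite -[X in _ --> X]subr0; apply: cvgB => //; exact: cvg_cst.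
have mDs n : measurable_fun setT (fun x => (D x * s n x)%:E).
  by apply/measurable_EFinP; exact: measurable_funM.
have mlim : measurable_fun setT (fun x => (density_ratio x * u x)%:E).
  exact: measurable_int iu.
have Ds_cvg : {ae mu, forall x, setT x ->
    (D x * s n x)%:E @[n --> \oo] --> (density_ratio x * u x)%:E}.
  apply: aeW => x _; apply: cvg_EFin; first exact: nearW.
  by rewrite -Dg; apply: cvgMr; exact: s_cvg.
have Ds_le : {ae mu, forall x n, setT x ->
    `|(D x * s n x)%:E| <= `|density_ratio x * u x|%:E}.
  apply: aeW => x n _; rewrite lee_fin -Dg.
  rewrite (normrM (D x) (s n x)) (normrM (D x) (g x)); apply: ler_wpM2l => //.
  by rewrite (ger0_norm (g0 x)) ger0_norm //; exact: s_le.
have [_ _ c2] := dominated_convergence measurableT mDs mlim Ds_cvg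
  (integrable_abse iu) Ds_le.
have bs : (fun n => (beta (fun x => w x * s n x)%R)%:E) =
    (fun n => \int[mu]_x (D x * s n x)%:E).
  by apply/funext => n; case: (ms n).
by rewrite bs in c1; exact: cvg_unique c1 c2.
Qed.
End approximation.
End density.
End weight.

(** Every u in X is the combination |u| - (|u| - u) of nonnegative elements of X.
    Integrability of psi u for a u of arbitrary norm follows from the bound on the
    unit ball by scaling. *)
Lemma order_continuous_representation : exists psi : T -> R,
  [/\ measurable_fun setT psi,
      forall u, XR u -> rho (cplx u) <= 1 ->
        \int[mu]_x `|psi x * u x|%:E <= K%:E,
      forall u, XR u -> mu.-integrable setT (fun x => (psi x * u x)%:E) &
      forall u, XR u -> (beta u)%:E = \int[mu]_x (psi x * u x)%:E].
Proof.
have [w [Xw w0]] := exists_positive_real_space rhoN.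
have [D [iD DE]] := exists_density Xw w0.
pose psi := density_ratio w D.
have mpsi : measurable_fun setT psi by exact: measurable_density_ratio.
have Xabs u : XR u -> XR (fun x => `|u x|%R).
  move=> Xu; apply: (real_space_le rhoN Xu).
    by apply: measurableT_comp => //; case: Xu.
  by move=> x; rewrite normr_id.
have bound u : XR u -> rho (cplx u) <= 1 ->
    \int[mu]_x `|psi x * u x|%:E <= K%:E.
  move=> Xu u1.
  have u1' : rho (cplx (fun x => `|u x|%R)) <= 1.
    apply: le_trans u1; apply: (rho_le rhoN).
    - by apply: cplx_Mfun; case: (Xabs _ Xu).
    - by apply: cplx_Mfun; case: Xu.
    - by apply: aeW => x; rewrite !ecabs_cplx normr_id.
  have := integral_density_le Xw w0 iD DE (Xabs _ Xu) (fun x => normr_ge0 _) u1'.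
  by under eq_integral do rewrite normrM normr_id -normrM.
have integrable_psi u : XR u -> mu.-integrable setT (fun x => (psi x * u x)%:E).
  move=> Xu; have [mu' ru] := Xu.
  have r0 := qbfn_ge0 rhoN (cplx_Mfun mu').
  have rfin : rho (cplx u) \is a fin_num by rewrite ge0_fin_numE.
  pose c := (1 + fine (rho (cplx u)))^-1%R.
  have c0 : (0 < c)%R by rewrite invr_gt0 ltr_pwDl // fine_ge0.
  have mpu : measurable_fun setT (fun x => (psi x * u x)%:E).
    by apply/measurable_EFinP; exact: measurable_funM.
  apply/integrableP; split => //.
  have Xcu := real_space_scale rhoN c Xu.
  have cu1 : rho (cplx (fun x => c * u x)%R) <= 1.
    rewrite (rho_cplx_scale rhoN) // gtr0_norm // -(fineK rfin) -EFinM.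
    rewrite lee_fin /c mulrC ler_pdivrMr ?ltr_pwDl ?fine_ge0 //.
    by rewrite mul1r lerDr.
  have := bound _ Xcu cu1.
  rewrite (_ : (fun x => `|psi x * (c * u x)|%:E) =
               (fun x => c%:E * `|(psi x * u x)%:E|)); last first.
    by apply/funext => x; rewrite mulrCA normrM EFinM gtr0_norm.
  rewrite ge0_integralZl //; last 2 first.
  - exact: measurableT_comp.
  - by rewrite lee_fin ltW.
  move=> cK; rewrite ltey; apply/eqP => oo; move: cK.
  by rewrite oo gt0_muley // lte_fin.
have repr_ge0 u : XR u -> (forall x, 0 <= u x)%R ->
    (beta u)%:E = \int[mu]_x (psi x * u x)%:E.
  move=> Xu u0; apply: (represented_nonneg Xw w0 iD DE) => //.
  exact: integrable_psi.
exists psi; split => // u Xu.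
have Xa := Xabs _ Xu.
have Xd : XR (fun x => -1 * u x + `|u x|)%R.
  by apply: (real_space_add rhoN) => //; exact: (real_space_scale rhoN).
have d0 x : (0 <= -1 * u x + `|u x|)%R by rewrite mulN1r addrC subr_ge0 ler_norm.
have uE : u = (fun x => -1 * (-1 * u x + `|u x|) + `|u x|)%R.
  by apply/funext => x; ring.
rewrite [in LHS]uE (betaL _ Xd Xa) EFinD EFinM !repr_ge0 //.
rewrite -integralZl //; last exact: integrable_psi.
rewrite -integralD //; last 2 first.
- by apply: integrableZl => //; exact: integrable_psi.
- exact: integrable_psi.
apply: eq_integral => x _; rewrite -EFinM -EFinD; congr EFin; ring.
Qed.

End real_representation.

(** * Complex integrals *)

Section complex_integral_facts.
Local Open Scope ereal_scope.
Context d (T : measurableType d) (R : realType).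
Context (mu : {measure set T -> \bar R}).
Local Notation normc := ComplexField.Normc.normc.

Lemma integrable_ecRe k : Mfun k -> \int[mu]_x ecabs (k x) < +oo ->
  mu.-integrable setT (fun x => (ecRe (k x))%:E).
Proof.
move=> mk koo; have [_ mRe _] := mk; apply/integrableP; split.
  exact/measurable_EFinP.
apply: le_lt_trans koo; apply: ge0_le_integral => //.
- by apply: measurableT_comp => //; exact/measurable_EFinP.
- exact: Mfun_ecabs.
- by move=> x _; exact: norm_ecRe_le.
Qed.

Lemma integrable_ecIm k : Mfun k -> \int[mu]_x ecabs (k x) < +oo ->
  mu.-integrable setT (fun x => (ecIm (k x))%:E).
Proof.
move=> mk koo; have [_ _ mIm] := mk; apply/integrableP; split.
  exact/measurable_EFinP.
apply: le_lt_trans koo; apply: ge0_le_integral => //.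
- by apply: measurableT_comp => //; exact/measurable_EFinP.
- exact: Mfun_ecabs.
- by move=> x _; exact: norm_ecIm_le.
Qed.

Lemma normc_complex_integral_le k : Mfun k -> \int[mu]_x ecabs (k x) < +oo ->
  (normc (complex_integral mu k))%:E <=
    \int[mu]_x ecabs (k x) + \int[mu]_x ecabs (k x).
Proof.
move=> mk koo; have [_ mRe mIm] := mk.
have iRe := integrable_ecRe mk koo; have iIm := integrable_ecIm mk koo.
have mE := Mfun_ecabs mk.
apply: (@le_trans _ _ (`|\int[mu]_x (ecRe (k x))%:E| +
                       `|\int[mu]_x (ecIm (k x))%:E|)).
  rewrite -(fineK (integrable_fin_num measurableT iRe)).
  rewrite -(fineK (integrable_fin_num measurableT iIm)).
  by rewrite -EFinD lee_fin; exact: normc_le.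
apply: leeD; (apply: le_trans (le_abse_integral _ _ _) _; [exact: measurableT|
    exact/measurable_EFinP|]); apply: ge0_le_integral => //.
- by apply: measurableT_comp => //; exact/measurable_EFinP.
- by move=> x _; exact: norm_ecRe_le.
- by apply: measurableT_comp => //; exact/measurable_EFinP.
- by move=> x _; exact: norm_ecIm_le.
Qed.

Lemma Re_complex_integral k : complex.Re (complex_integral mu k) =
  fine (\int[mu]_x (ecRe (k x))%:E).
Proof. by []. Qed.

Lemma Im_complex_integral k : complex.Im (complex_integral mu k) =
  fine (\int[mu]_x (ecIm (k x))%:E).
Proof. by []. Qed.

Lemma ae_eq_indic_integrals (h1 h2 : T -> R) :
  mu.-integrable setT (EFin \o h1) -> mu.-integrable setT (EFin \o h2) ->
  (forall A, measurable A -> fine (\int[mu]_x (h1 x * \1_A x)%:E) =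
                             fine (\int[mu]_x (h2 x * \1_A x)%:E)) ->
  {ae mu, forall x, h1 x = h2 x}.
Proof.
have cut (h : T -> R) A :
    \int[mu]_x (h x * \1_A x)%:E = \int[mu]_(x in A) (h x)%:E.
  rewrite [RHS]integral_mkcond; apply: eq_integral => x _.
  by rewrite patchE indicE; case: ifP; rewrite ?mulr1 ?mulr0.
move=> i1 i2 eq12; have int_fin (h : T -> R) A : measurable A ->
    mu.-integrable setT (EFin \o h) -> \int[mu]_(x in A) (h x)%:E \is a fin_num.
  move=> mA ih; apply: integrable_fin_num => //.
  exact: (@integrableS _ _ _ mu setT).
have ae12 : ae_eq mu setT (EFin \o h1) (EFin \o h2).
  apply: integral_ae_eq => //; first exact: measurable_int i2.
  move=> A _ mA; rewrite -(fineK (int_fin _ _ mA i1)) -(fineK (int_fin _ _ mA i2)).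
  by congr EFin; rewrite -!(cut _ A) eq12.
by apply: filterS ae12 => x /(_ I) [].
Qed.

End complex_integral_facts.

(** * The dual of X for xi *)

Section associate_functionals.
Local Open Scope ereal_scope.
Context d (T : measurableType d) (R : realType).
Context (mu : {sigma_finite_measure set T -> \bar R}).
Context (rho : (T -> ecomplex R) -> \bar R).
Hypothesis rhoN : quasi_banach_function_norm mu rho.
Local Notation X := (xi_space mu rho).
Local Notation normc := ComplexField.Normc.normc.
Implicit Types phi psi : T -> ecomplex R.

Lemma integral_ecmul_lty phi f : associate_space mu rho phi ->
  function_space rho f -> \int[mu]_x ecabs (ecmul (phi x) (f x)) < +oo.
Proof.
move=> [mphi phioo] Xf; under eq_integral do rewrite ecabs_mul.
apply: le_lt_trans (associate_holder rhoN mphi Xf) _.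
have [mf rf] := Xf; apply: lte_mul_pinfty => //.
  exact: (associate_norm_ge0 rhoN).
by rewrite ge0_fin_numE // (associate_norm_ge0 rhoN).
Qed.

(** On the functions w 1_A equality of the functionals says that phi w and psi w
    have the same integral over every measurable set; as w > 0 is in X, both are
    integrable, so that phi and psi are finite almost everywhere. *)
Lemma associate_space_unique phi psi :
  associate_space mu rho phi -> associate_space mu rho psi ->
  (forall f : X, complex_integral mu (fun x => ecmul (phi x) (sval f x)) =
                 complex_integral mu (fun x => ecmul (psi x) (sval f x))) ->
  {ae mu, forall x, psi x = phi x}.
Proof.
move=> Xphi Xpsi eq_int.
have [w [Xw w0]] := exists_positive_real_space rhoN.
have [mw rw] := Xw.
pose wX : X := exist _ (cplx w) (cplx_function_space Xw).
pose k chi x := ecmul (chi x) (cplx w x).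
have Mk chi : associate_space mu rho chi -> Mfun (k chi).
  by move=> [mchi _]; apply: Mfun_mul => //; exact: cplx_Mfun.
have koo chi : associate_space mu rho chi -> \int[mu]_x ecabs (k chi x) < +oo.
  by move=> Xchi; exact: (integral_ecmul_lty Xchi (svalP wX)).
have fin chi : associate_space mu rho chi -> {ae mu, forall x, chi x <> None}.
  move=> Xchi; have : mu.-integrable setT (fun x => ecabs (k chi x)).
    apply/integrableP; split; first exact: Mfun_ecabs (Mk _ Xchi).
    by under eq_integral do rewrite gee0_abs ?ecabs_ge0 //; exact: koo.
  move/(integrable_ae measurableT); apply: filterS => x /(_ I) + chix.
  by rewrite /k chix /= eq_complex /= gt_eqF.
have ReE chi x : ecRe (k chi x) = (ecRe (chi x) * w x)%R.
  by rewrite ecRe_mul /= mulr0 subr0.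
have ImE chi x : ecIm (k chi x) = (ecIm (chi x) * w x)%R.
  by rewrite ecIm_mul /= mulr0 add0r.
have XwA A : measurable A -> real_space rho (fun x => w x * \1_A x)%R.
  exact: (real_space_weighted_indic rhoN Xw).
have aeRe : {ae mu, forall x, ecRe (k psi x) = ecRe (k phi x)}.
  apply: ae_eq_indic_integrals;
    [by apply: integrable_ecRe; [exact: Mk|exact: koo]..|move=> A mA].
  have /(congr1 (@complex.Re R)) :=
    eq_int (exist _ _ (cplx_function_space (XwA _ mA))).
  rewrite !Re_complex_integral.
  have E chi :
      (fun x => (ecRe (ecmul (chi x) (cplx (fun x => w x * \1_A x)%R x)))%:E)
      = (fun x => (ecRe (k chi x) * \1_A x)%:E).
    by apply/funext => x; rewrite ReE ecRe_mul /= mulr0 subr0 mulrA.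
  by rewrite !E.
have aeIm : {ae mu, forall x, ecIm (k psi x) = ecIm (k phi x)}.
  apply: ae_eq_indic_integrals;
    [by apply: integrable_ecIm; [exact: Mk|exact: koo]..|move=> A mA].
  have /(congr1 (@complex.Im R)) :=
    eq_int (exist _ _ (cplx_function_space (XwA _ mA))).
  rewrite !Im_complex_integral.
  have E chi :
      (fun x => (ecIm (ecmul (chi x) (cplx (fun x => w x * \1_A x)%R x)))%:E)
      = (fun x => (ecIm (k chi x) * \1_A x)%:E).
    by apply/funext => x; rewrite ImE ecIm_mul /= mulr0 add0r mulrA.
  by rewrite !E.
have FF := ae_filter_ringOfSetsType mu.
have aeReIm := @filterI _ _ FF _ _ aeRe aeIm.
have aefin := @filterI _ _ FF _ _ (fin _ Xphi) (fin _ Xpsi).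
move: aeReIm aefin; apply: filterS2 => x []; rewrite !ReE !ImE.
move=> /(mulIf (lt0r_neq0 (w0 x))) eRe /(mulIf (lt0r_neq0 (w0 x))) eIm.
move=> [phix psix].
case: (phi x) (psi x) phix psix eRe eIm => [[a b]|] [[a' b']|] //= _ _.
by move=> -> ->.
Qed.

Section continuity.
Hypothesis res : resonant mu.
Hypothesis ri : rearrangement_invariant mu rho.
Variable alpha : X -> R[i]^o.
Hypothesis alphaL : linear_functional alpha.

(** The difference f - f is infinite where f is, hence 0 only almost
    everywhere. *)
Lemma xi_ball_center phi (f : X) (e : R) : associate_space mu rho phi ->
  (0 < e)%R -> @xi_ball _ _ _ mu rho phi f e f.
Proof.
move=> [mphi phioo] e0.
rewrite xi_ballE; set z := ecsub _ _.
have Xz : function_space rho z.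
  exact: (function_space_sub rhoN (svalP f) (svalP f)).
have rz : rho z = 0.
  apply/eqP; rewrite eq_le (qbfn_ge0 rhoN) ?andbT; last by case: Xz.
  rewrite -(rho_cplx0 rhoN); apply: (rho_le rhoN); [by case: Xz|exact: cplx_Mfun|].
  apply: filterS (function_space_ae_finite rhoN (svalP f)) => x.
  rewrite ecabs_cplx normr0 /z /ecsub; case: (sval f x) => [c|] // _.
  by rewrite ecsubrr /ecabs ComplexField.Normc.normc0.
apply: le_lt_trans (pairing_le_norm res rhoN ri mphi Xz) _.
by rewrite rz mule0 lte_fin.
Qed.

Lemma integral_functional_continuous phi : associate_space mu rho phi ->
  (forall f : X,
    alpha f = complex_integral mu (fun x => ecmul (phi x) (sval f x))) ->
  continuous alpha.
Proof.
move=> Xphi alphaE f U /nbhs_complexP [e e0 eU].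
have [mphi _] := Xphi.
have e2 : (0 < e / 2)%R by rewrite divr_gt0.
have := xi_ball_nbhs Xphi e2 (xi_ball_center f Xphi e2).
apply: filterS => g.
rewrite xi_ballE; set h := ecsub _ _ => hg.
have Xh : function_space rho h.
  exact: (function_space_sub rhoN (svalP g) (svalP f)).
pose hX : X := exist _ h Xh.
have alphah : alpha hX = (alpha g - alpha f)%R.
  rewrite (alphaL (a := (-1)%R) (f := f) (g := g)); first by rewrite mulN1r addrC.
  by apply: aeW => x; rewrite /= /h /ecsub ecaddC.
apply: eU; rewrite -alphah alphaE.
have mk : Mfun (fun x => ecmul (phi x) (h x)).
  by apply: Mfun_mul => //; exact: (proj1 Xh).
have koo := integral_ecmul_lty Xphi Xh.
rewrite -lte_fin; apply: le_lt_trans (normc_complex_integral_le mk koo) _.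
have le_e2 : \int[mu]_x ecabs (ecmul (phi x) (h x)) < (e / 2)%:E.
  apply: le_lt_trans hg; under eq_integral do rewrite ecabs_mul.
  by apply: (integral_le_pairing res) => //; exact: (proj1 Xh).
by rewrite [e in X in _ < X]splitr EFinD; apply: lteD.
Qed.
End continuity.

Section representation.
Hypothesis res : resonant mu.
Hypothesis ri : rearrangement_invariant mu rho.
Hypothesis acr : ACR mu rho.
Variable alpha : X -> R[i]^o.
Hypothesis alphaL : linear_functional alpha.
Hypothesis alphaC : continuous alpha.
Local Notation XR := (real_space rho).

(** The functional alpha on the real functions of X, extended by 0 to a total
    function so that sums need not be packed with a proof of membership. *)
Definition real_restriction (u : T -> R) : R[i] :=
  match pselect (XR u) with
  | left Xu => alpha (exist _ (cplx u) (cplx_function_space Xu))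
  | right _ => 0%R
  end.

Lemma real_restrictionE (u : T -> R) (Xu : XR u) :
  real_restriction u = alpha (exist _ (cplx u) (cplx_function_space Xu)).
Proof.
rewrite /real_restriction; case: pselect => // Xu'.
by congr (alpha (exist _ _ _)); exact: Prop_irrelevance.
Qed.

Lemma real_restriction_lin (a : R) u v : XR u -> XR v ->
  real_restriction (fun x => a * u x + v x)%R =
  (a%:C%C * real_restriction u + real_restriction v)%R.
Proof.
move=> Xu Xv; have Xuv : XR (fun x => a * u x + v x)%R.
  by apply: (real_space_add rhoN) => //; exact: (real_space_scale rhoN).
rewrite !real_restrictionE; apply: alphaL; apply: aeW => x.
by rewrite /= /cplx rmorphD rmorphM.
Qed.

Lemma real_restriction_ae_eq0 u : XR u -> {ae mu, forall x, u x = 0%R} ->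
  real_restriction u = 0%R.
Proof.
move=> Xu u0; rewrite real_restrictionE.
apply: (linear_functional_ae_eq0 alphaL).
by apply: filterS u0 => x /= ux; rewrite /cplx ux.
Qed.

Lemma real_restriction_cvg0 (v : nat -> T -> R) : XR (v 0%N) ->
  (forall n, measurable_fun setT (v n)) ->
  (forall n x, 0 <= v n x)%R -> (forall x, nonincreasing_seq (v ^~ x)) ->
  (forall x, v n x @[n --> \oo] --> (0%R : R)) ->
  forall e : R, (0 < e)%R -> \forall n \near \oo,
    (normc (real_restriction (v n)) < e)%R.
Proof.
move=> Xv mv v0 niv cv.
have Xvn n : XR (v n).
  apply: (real_space_le rhoN Xv) => // x.
  by rewrite !ger0_norm //; exact: niv.
pose h n : X := exist _ _ (cplx_function_space (Xvn n)).
have := @xi_continuous_cvg0 _ _ _ mu rho rhoN alpha alphaL alphaC res h.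
move=> H e e0; have : \forall n \near \oo, (normc (alpha (h n)) < e)%R.
  apply: H => // phi Xphi.
  exact: (pairing_cvg0 res rhoN ri acr Xphi Xv mv v0 niv cv).
by apply: filterS => n; rewrite real_restrictionE.
Qed.

(** Applied to the real and to the imaginary part: alpha is treated as a pair of
    real linear functionals on the real functions of X. *)
Lemma part_represented (p : R[i] -> R) (K : R) :
  (forall (a : R) z y, p (a%:C%C * z + y) = a * p z + p y)%R ->
  (forall z, `|p z| <= normc z)%R ->
  (forall h : X, rho (sval h) <= 1 -> (normc (alpha h) <= K)%R) ->
  exists psi : T -> R, [/\ measurable_fun setT psi,
    forall u, XR u -> rho (cplx u) <= 1 ->
      \int[mu]_x `|psi x * u x|%:E <= K%:E,
    forall u, XR u -> mu.-integrable setT (fun x => (psi x * u x)%:E) &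
    forall u, XR u -> (p (real_restriction u))%:E =
      \int[mu]_x (psi x * u x)%:E].
Proof.
move=> pL p_le alphaK.
have p0 : p 0%R = 0%R.
  by apply/eqP; rewrite -normr_le0 (le_trans (p_le _)) //
    ComplexField.Normc.normc0.
apply: (@order_continuous_representation _ _ _ mu rho rhoN
  (fun u => p (real_restriction u)) _ _ _ K).
- by move=> a u v Xu Xv; rewrite real_restriction_lin.
- by move=> u Xu u0; rewrite real_restriction_ae_eq0.
- move=> v Xv mv v0 niv cv; apply/cvgrPdist_lt => e e0.
  apply: filterS (real_restriction_cvg0 Xv mv v0 niv cv e0) => n.
  by rewrite sub0r normrN; exact: le_lt_trans.
- move=> u Xu u1; apply: le_trans (p_le _) _.
  by rewrite real_restrictionE; exact: alphaK.
Qed.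

(** If psi1 and psi2 represent the real and the imaginary part of alpha on real
    functions, then phi = psi1 + i psi2 represents alpha on X, since
    f = Re f + i Im f almost everywhere. *)
Lemma xi_continuous_represented : exists phi, associate_space mu rho phi /\
  forall f : X,
    alpha f = complex_integral mu (fun x => ecmul (phi x) (sval f x)).
Proof.
have [K alphaK] := xi_continuous_bounded rhoN alphaL alphaC res ri.
have ReL (a : R) (z y : R[i]) :
    (complex.Re (a%:C%C * z + y) = a * complex.Re z + complex.Re y)%R.
  by case: z y => [? ?] [? ?] /=; ring.
have ImL (a : R) (z y : R[i]) :
    (complex.Im (a%:C%C * z + y) = a * complex.Im z + complex.Im y)%R.
  by case: z y => [? ?] [? ?] /=; ring.
have [psi1 [mpsi1 bpsi1 ipsi1 psi1E]] :=
  part_represented ReL (@Re_le_normc R) alphaK.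
have [psi2 [mpsi2 bpsi2 ipsi2 psi2E]] :=
  part_represented ImL (@Im_le_normc R) alphaK.
pose phi x : ecomplex R := Some (psi1 x +i* psi2 x)%C.
have mphi : Mfun phi by exact: Mfun_ReIm.
exists phi; split.
  split => //; apply: (@le_lt_trans _ _ (K%:E + K%:E)); last by rewrite -EFinD ltry.
  apply: ge_ereal_sup => _ [g [mg g1] <-].
  have Xg : function_space rho g by split => //; exact: le_lt_trans g1 (ltry _).
  pose a x := fine (ecabs (g x)).
  have ma : measurable_fun setT a.
    by apply: measurableT_comp => //; exact: Mfun_ecabs.
  have a0 x : (0 <= a x)%R by rewrite fine_ge0 // ecabs_ge0.
  have a1 : rho (cplx a) <= 1.
    apply: le_trans g1; apply: (rho_le rhoN) => //; first exact: cplx_Mfun.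
    apply: aeW => x; rewrite ecabs_cplx ger0_norm // /a.
    by case: (g x) => [c|] //=; rewrite leey.
  have Xa : XR a by split => //; exact: le_lt_trans a1 (ltry _).
  have mpa (q : T -> R) : measurable_fun setT q ->
      measurable_fun setT (fun x => `|q x * a x|%:E).
    move=> mq; apply/measurable_EFinP; apply: measurableT_comp => //.
    exact: measurable_funM.
  apply: (@le_trans _ _ (\int[mu]_x (`|psi1 x * a x|%:E + `|psi2 x * a x|%:E))).
    apply: ae_ge0_le_integral => //.
    - by move=> x _; rewrite mule_ge0 // ecabs_ge0.
    - exact: measurable_abs_mul.
    - by move=> x _; rewrite adde_ge0.
    - by apply: emeasurable_funD; exact: mpa.
    - apply: filterS (function_space_ae_finite rhoN Xg) => x gx _.
      have -> : ecabs (g x) = (a x)%:E.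
        by rewrite /a; move: gx; case: (g x).
      rewrite -EFinM -EFinD lee_fin !normrM -mulrDl (ger0_norm (a0 x)).
      by rewrite ler_wpM2r //; exact: normc_le.
  rewrite ge0_integralD //; [|exact: mpa..].
  by apply: leeD; [exact: bpsi1|exact: bpsi2].
move=> f.
have XRe := function_space_Re rhoN (svalP f).
have XIm := function_space_Im rhoN (svalP f).
have -> : alpha f = ('i%C * real_restriction (fun x => ecIm (sval f x)) +
    real_restriction (fun x => ecRe (sval f x)))%R.
  rewrite !real_restrictionE; apply: alphaL.
  apply: filterS (function_space_ae_finite rhoN (svalP f)) => x /=.
  rewrite /cplx; case: (sval f x) => [[a b]|] // _; rewrite /ecadd /ecmul /=.
  congr Some; apply/eqP; rewrite eq_complex /=.
  by apply/andP; split; apply/eqP; ring.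
have rE (q u : T -> R) (c : R) : c%:E = \int[mu]_x (q x * u x)%:E ->
    c = (\int[mu]_x (q x * u x))%R by move=> cE; rewrite /Rintegral -cE.
have A1 := rE _ _ _ (psi1E _ XRe).
have A2 := rE _ _ _ (psi2E _ XRe).
have B1 := rE _ _ _ (psi1E _ XIm).
have B2 := rE _ _ _ (psi2E _ XIm).
have Ere : (fun x => ecRe (ecmul (phi x) (sval f x))) =
    (fun x => psi1 x * ecRe (sval f x) - psi2 x * ecIm (sval f x))%R.
  by apply/funext => x; rewrite ecRe_mul.
have Eim : (fun x => ecIm (ecmul (phi x) (sval f x))) =
    (fun x => psi1 x * ecIm (sval f x) + psi2 x * ecRe (sval f x))%R.
  by apply/funext => x; rewrite ecIm_mul.
rewrite /complex_integral Ere Eim RintegralB ?RintegralD //;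
  try exact: ipsi1; try exact: ipsi2.
rewrite -A1 -A2 -B1 -B2.
case: (real_restriction _) => a b; case: (real_restriction _) => c d'.
by apply/eqP; rewrite eq_complex /=; apply/andP; split; apply/eqP; ring.
Qed.

End representation.
End associate_functionals.

Theorem theorem4p15 (d : measure_display) (T : measurableType d) (R : realType)
    (mu : {sigma_finite_measure set T -> \bar R})
    (rho : (T -> ecomplex R) -> \bar R) :
  resonant mu ->
  quasi_banach_function_norm mu rho ->
  P5 mu rho ->
  rearrangement_invariant mu rho ->
  ACR mu rho ->
  forall alpha : xi_space mu rho -> R[i]^o, linear_functional alpha ->
    continuous alpha <->
    exists phi : T -> ecomplex R,
      [/\ associate_space mu rho phi,
          forall f : xi_space mu rho,
            alpha f = complex_integral mu (fun x => ecmul (phi x) (sval f x)) &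
          forall psi : T -> ecomplex R, associate_space mu rho psi ->
            (forall f : xi_space mu rho,
              alpha f =
                complex_integral mu (fun x => ecmul (psi x) (sval f x))) ->
            {ae mu, forall x, psi x = phi x}].
Proof.
move=> res rhoN _ ri acr alpha alphaL; split=> [alphaC|[phi [Xphi phiE _]]].
  have [phi [Xphi phiE]] := xi_continuous_represented rhoN res ri acr alphaL alphaC.
  exists phi; split => // psi Xpsi psiE.
  by apply: (associate_space_unique rhoN Xphi Xpsi) => f; rewrite -phiE -psiE.
exact: (integral_functional_continuous rhoN res ri alphaL Xphi phiE).
Qed.
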